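(* Let $p\ge 2$ be an integer. Let $F:\mathbb{R}^d\to\mathbb{R}^d$ be monotone and $p-1$ times continuously differentiable with $\|D^{p-1}F(z)-D^{p-1}F(z')\|_{\mathrm{op}}\le L_p\|z-z'\|$ for all $z,z'\in\mathbb{R}^d$, where $L_p>0$; let $H:\mathbb{R}^d\rightrightarrows\mathbb{R}^d$ be maximally monotone, and let $z^*$ satisfy $0\in F(z^* )+H(z^* )$. Let $z_0\in\operatorname{dom}(H)$ and $\varepsilon>0$. Then the AEP Tensor method (defined in the context) returns a point $\widehat z$ satisfying $\mathrm{res}^{\mathrm{tan}}(\widehat z)\le\varepsilon$ after at most $$\mathcal{O}_p\left(1+\left(\frac{L_p\|z_0-z^*\|^p}{\varepsilon}\right)^{2/(3p-1)}\right)$$ outer iterations, where the constant hidden in $\mathcal{O}_p$ depends only on $p$.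
   Context: Norms are Euclidean; $\|\cdot\|_{\mathrm{op}}$ is the induced (multilinear) operator norm. $\operatorname{dom}(H)=\{z:H(z)\ne\emptyset\}$. The tangent residual is $\mathrm{res}^{\mathrm{tan}}(z)=\inf_{v\in H(z)}\|F(z)+v\|$. Regularized Taylor model. Put $\lambda=L_p$, $M_p=L_p+p\lambda=(p+1)L_p$, $\rho=1/\sqrt2$, and $$T_\lambda^{(p-1)}(z';z)=F(z)+\sum_{i=1}^{p-1}\frac1{i!}D^iF(z)[z'-z]^i+\frac{\lambda}{(p-1)!}\|z'-z\|^{p-1}(z'-z).$$ For $\lambda\ge L_p$ the map $T_\lambda^{(p-1)}(\cdot;z)$ is maximal monotone with domain $\mathbb{R}^d$ (known fact), so the subproblem below has a unique solution. AEP Tensor method. Input: $p$, $z_0\in\operatorname{dom}(H)$, $\varepsilon>0$, $L_p$. Choose $v_0\in H(z_0)$ and set $A_0=0$. For $k=0,1,2,\dots$: (1) If $\|F(z_k)+v_k\|\le\varepsilon$, stop and return $z_k$. (2) Otherwise run the line search. For a trial step size $a>0$, a trial evaluation consists of computing $$z_{k+1/2}(a)=\frac{a}{A_k+a}z_0+\frac{A_k}{A_k+a}\bigl(z_k-a(F(z_k)+v_k)\bigr),\qquad P_{k,a}(z)=T_\lambda^{(p-1)}(z;z_{k+1/2}(a)),$$ the unique solution $z_{k+1}(a)$ of $$0\in aP_{k,a}(z_{k+1}(a))+aH(z_{k+1}(a))+z_{k+1}(a)-\Bigl(\frac{a}{A_k+a}z_0+\frac{A_k}{A_k+a}z_k\Bigr),$$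 and $$v_{k+1}(a)=\frac1a\Bigl(\frac{a}{A_k+a}z_0+\frac{A_k}{A_k+a}z_k-z_{k+1}(a)\Bigr)-P_{k,a}(z_{k+1}(a))\in H(z_{k+1}(a)).$$ The merit function is $\psi_k(a)=M_p\,a\,\|z_{k+1}(a)-z_{k+1/2}(a)\|^{p-1}$ for $a>0$, $\psi_k(0)=0$. The upper trial value is $$\bar a_k=\max\left\{\frac{2A_k\|F(z_k)+v_k\|}{\varepsilon},\ \left(\frac{2(1+\rho)}{\varepsilon}\Bigl(\frac{p!\rho}{M_p}\Bigr)^{1/(p-1)}\right)^{(p-1)/p}\right\}.$$ First evaluate the trial $a=\bar a_k$. If $\psi_k(\bar a_k)\le p!\rho$, the whole method terminates and returns $z_{k+1}(\bar a_k)$. Otherwise set $a^-=0$, $a^+=\bar a_k$ and repeat (bisection phase): evaluate the trial $a=(a^-+a^+)/2$; if $\psi_k(a)<p!\rho/\sqrt2=p!/2$ set $a^-\leftarrow a$; if $\psi_k(a)>p!\rho=p!/\sqrt2$ set $a^+\leftarrow a$; otherwise accept $a_k=a$ and leave the loop. (3) After acceptance set $z_{k+1/2}=z_{k+1/2}(a_k)$, $z_{k+1}=z_{k+1}(a_k)$, $v_{k+1}=v_{k+1}(a_k)$, $A_{k+1}=A_k+a_k$. An outer iteration means one accepted update $k\to k+1$. *)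

(* Defs.v *)
From HB Require Import structures.
From mathcomp Require Import all_boot all_order all_algebra.
From mathcomp Require Import all_classical all_reals all_analysis.
Set Implicit Arguments.
Unset Strict Implicit.
Unset Printing Implicit Defensive.
Import Order.TTheory GRing.Theory Num.Theory.
Import numFieldNormedType.Exports.
Local Open Scope classical_set_scope.
Local Open Scope ring_scope.

(* The library norm on 'rV[R]_d is the sup norm. It induces the usual topology,
   hence the usual notions of continuity and differentiability, but all metric
   statements below use the Euclidean norm. *)
Definition dot (R : realType) (d : nat) (x y : 'rV[R]_d) : R :=
  \sum_(i < d) x 0 i * y 0 i.

Definition enorm (R : realType) (d : nat) (x : 'rV[R]_d) : R :=
  Num.sqrt (dot x x).

(* iterdiff F [:: h_1; ...; h_i] z = D^i F(z)[h_1, ..., h_i]: the iterated Frechet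
   derivative, applied to its arguments one at a time. *)
Fixpoint iterdiff (R : realType) (d : nat) (F : 'rV[R]_d -> 'rV[R]_d)
    (hs : seq 'rV[R]_d) : 'rV[R]_d -> 'rV[R]_d :=
  if hs is h :: hs' then fun z => 'd (iterdiff F hs') z h else F.

(* Since the dimension is finite, differentiability (resp. continuity) of
   z |-> D^i F(z) as a map into the i-linear maps is differentiability (resp.
   continuity) of z |-> D^i F(z)[h_1, ..., h_i] for all h_1, ..., h_i. *)
Definition continuously_differentiable (R : realType) (d k : nat)
    (F : 'rV[R]_d -> 'rV[R]_d) : Prop :=
  (forall hs : seq 'rV[R]_d, (size hs < k)%N ->
     forall z, differentiable (iterdiff F hs) z) /\
  (forall hs : seq 'rV[R]_d, size hs = k -> continuous (iterdiff F hs)).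

(* Taken in the extended reals, so that no boundedness is presupposed. *)
Definition opnorm (R : realType) (d k : nat)
    (T : k.-tuple 'rV[R]_d -> 'rV[R]_d) : \bar R :=
  ereal_sup [set (enorm (T h))%:E | h in
    [set h : k.-tuple 'rV[R]_d | forall i, enorm (tnth h i) <= 1]].

Definition monotone_map (R : realType) (d : nat) (F : 'rV[R]_d -> 'rV[R]_d) :
    Prop :=
  forall x y, 0 <= dot (F x - F y) (x - y).

Definition monotone_op (R : realType) (d : nat)
    (H : 'rV[R]_d -> set 'rV[R]_d) : Prop :=
  forall x y u v, H x u -> H y v -> 0 <= dot (u - v) (x - y).

Definition maximal_monotone (R : realType) (d : nat)
    (H : 'rV[R]_d -> set 'rV[R]_d) : Prop :=
  monotone_op H /\
  forall G : 'rV[R]_d -> set 'rV[R]_d, monotone_op G ->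
    (forall x, H x `<=` G x) -> forall x, G x `<=` H x.

Definition op_dom (R : realType) (d : nat) (H : 'rV[R]_d -> set 'rV[R]_d) :
    set 'rV[R]_d :=
  [set z | H z !=set0].

Definition res_tan (R : realType) (d : nat) (F : 'rV[R]_d -> 'rV[R]_d)
    (H : 'rV[R]_d -> set 'rV[R]_d) (z : 'rV[R]_d) : \bar R :=
  ereal_inf [set (enorm (F z + v))%:E | v in H z].

(* The state (z_k, v_k, A_k) at the start of outer iteration k. *)
Record aep_state (R : realType) (d : nat) := AepState {
  aep_z : 'rV[R]_d;
  aep_v : 'rV[R]_d;
  aep_A : R }.

Section AEP.
Variables (R : realType) (p d : nat).
Variables (F : 'rV[R]_d -> 'rV[R]_d) (H : 'rV[R]_d -> set 'rV[R]_d).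
Variables (Lp : R) (z0 : 'rV[R]_d) (eps : R).

Definition aep_lambda : R := Lp.
Definition aep_M : R := Lp + p%:R * aep_lambda.
Definition aep_rho : R := (Num.sqrt 2)^-1.

Definition taylor (z' z : 'rV[R]_d) : 'rV[R]_d :=
  F z + \sum_(1 <= i < p) (i`!%:R)^-1 *: iterdiff F (nseq i (z' - z)) z
  + (aep_lambda / (p.-1)`!%:R * enorm (z' - z) ^+ p.-1) *: (z' - z).

Section Trial.
Variables (st : aep_state R d) (a : R).
Let zk := aep_z st.
Let vk := aep_v st.
Let Ak := aep_A st.

Definition aep_anchor : 'rV[R]_d :=
  (a / (Ak + a)) *: z0 + (Ak / (Ak + a)) *: zk.

Definition aep_half : 'rV[R]_d :=
  (a / (Ak + a)) *: z0 + (Ak / (Ak + a)) *: (zk - a *: (F zk + vk)).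

Definition aep_P (z : 'rV[R]_d) : 'rV[R]_d := taylor z aep_half.

Definition aep_subproblem (z : 'rV[R]_d) : Prop :=
  exists2 h, H z h & 0 = a *: aep_P z + a *: h + z - aep_anchor.

(* The subproblem has exactly one solution when a > 0, by maximal monotonicity
   of aep_P and H; get selects it. *)
Definition aep_next : 'rV[R]_d := get aep_subproblem.

Definition aep_vnext : 'rV[R]_d :=
  a^-1 *: (aep_anchor - aep_next) - aep_P aep_next.

(* This also gives the convention psi_k(0) = 0. *)
Definition aep_psi : R := aep_M * a * enorm (aep_next - aep_half) ^+ p.-1.

Definition aep_update : aep_state R d :=
  AepState aep_next aep_vnext (Ak + a).

End Trial.

Definition aep_abar (st : aep_state R d) : R :=
  Num.max
    (2 * aep_A st * enorm (F (aep_z st) + aep_v st) / eps)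
    ((2 * (1 + aep_rho) / eps *
      (p`!%:R * aep_rho / aep_M) `^ (p.-1%:R)^-1) `^ (p.-1%:R / p%:R)).

(* aep_bisect st lo hi a: the bisection loop started with a^- = lo, a^+ = hi
   ends after finitely many halvings and accepts the step size a. *)
Inductive aep_bisect (st : aep_state R d) : R -> R -> R -> Prop :=
| Bisect_up lo hi a :
    aep_psi st ((lo + hi) / 2) < p`!%:R * aep_rho / Num.sqrt 2 ->
    aep_bisect st ((lo + hi) / 2) hi a ->
    aep_bisect st lo hi a
| Bisect_down lo hi a :
    p`!%:R * aep_rho < aep_psi st ((lo + hi) / 2) ->
    aep_bisect st lo ((lo + hi) / 2) a ->
    aep_bisect st lo hi a
| Bisect_accept lo hi :
    p`!%:R * aep_rho / Num.sqrt 2 <= aep_psi st ((lo + hi) / 2) ->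
    aep_psi st ((lo + hi) / 2) <= p`!%:R * aep_rho ->
    aep_bisect st lo hi ((lo + hi) / 2).

(* aep_run st n zhat: started in state st, the method terminates and returns
   zhat after exactly n accepted updates. The run is deterministic, so there is
   at most one pair (n, zhat) for each st. *)
Inductive aep_run : aep_state R d -> nat -> 'rV[R]_d -> Prop :=
| Run_stop st :
    enorm (F (aep_z st) + aep_v st) <= eps ->
    aep_run st 0 (aep_z st)
| Run_upper st :
    eps < enorm (F (aep_z st) + aep_v st) ->
    aep_psi st (aep_abar st) <= p`!%:R * aep_rho ->
    aep_run st 0 (aep_next st (aep_abar st))
| Run_accept st a n zhat :
    eps < enorm (F (aep_z st) + aep_v st) ->
    p`!%:R * aep_rho < aep_psi st (aep_abar st) ->
    aep_bisect st 0 (aep_abar st) a ->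
    aep_run (aep_update st a) n zhat ->
    aep_run st n.+1 zhat.

(* The whole method, for the initial choice v0 in H(z0). *)
Definition aep_tensor_returns (v0 : 'rV[R]_d) (n : nat) (zhat : 'rV[R]_d) :
    Prop :=
  aep_run (AepState z0 v0 0) n zhat.

End AEP.

(* Main.v *)
Require Import Defs.
From HB Require Import structures.
From mathcomp Require Import all_boot all_order all_algebra.
From mathcomp Require Import all_classical all_reals all_analysis.
From mathcomp Require Import ring lra.
Set Implicit Arguments.
Unset Strict Implicit.
Unset Printing Implicit Defensive.
Import Order.TTheory GRing.Theory Num.Theory.
Import numFieldNormedType.Exports.
Local Open Scope classical_set_scope.
Local Open Scope ring_scope.

(* The regularized Taylor model is [F], minus the Taylor remainder, plus the
   regularizer. With [n = p - 1], the remainder has slope at most [L |w|^n / n!]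
   along a segment; since [|w|^n] is convex, this is compensated by the
   monotonicity of [x |-> |x|^n x], so the model is monotone. Subproblems are
   therefore solvable by Minty's theorem, and their solutions depend continuously
   on the step size, so that the bisection terminates.

   Write [g = F z + v]. The anchored potential
   [A^2 |g|^2 / 2 + A <g, z - z0>] starts at 0, is bounded below by [- D^2 / 2]
   with [D = |z0 - z*|], and each accepted step decreases it by a quarter of
   [((A + a) r / a)^2], where [r] is the distance from the extrapolated point to
   the new iterate. In particular [A |g| <= 2 D], so [A] stays below
   [2 D / eps] until termination. The line search gives [a r^(p-1) >= c0], so
   every step either increases [A^(2/(3p-1))] or decreases the potential by a
   definite amount. The two budgets balance to the stated rate. *)

(** The exponent comes from the line search. Put [y = (A + a)^e]. If [a / (A + a)] is at least
    [mu / y], concavity makes [A^e] grow by at least [e mu]. Otherwise [(A + a) / a >= y / mu], and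
    [a r^(p-1) >= c0] bounds the squared movement below by a constant times
    [(y^p / (A + a))^(2/(p-1))]. This is [1 / y] exactly for [e = 2 / (3p - 1)], and
    [y <= Y = (2 D / eps)^e] until termination makes the bound uniform. The parameter [mu] is then
    chosen so that both kinds of steps have the same total cost.

    That uniform bound needs the new residual to be above [eps], so the step that reaches the target
    cannot be charged; this is the additive 1.

    Analysis is kept scalar: vector quantities are tested against a vector [e], finally taken to be
    the very quantity to be bounded, so that the mean value theorem can stand in for integral
    remainders. *)

Section Euclidean.
Variables (R : realType) (d : nat).
Implicit Types (x y z u v w : 'rV[R]_d) (c : R).

Lemma dotC x y : dot x y = dot y x.
Proof. by apply: eq_bigr => i _; rewrite mulrC. Qed.

Lemma dotDl x y z : dot (x + y) z = dot x z + dot y z.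
Proof.
by rewrite /dot -big_split; apply: eq_bigr => i _; rewrite mxE mulrDl.
Qed.

Lemma dotDr x y z : dot z (x + y) = dot z x + dot z y.
Proof. by rewrite dotC dotDl !(dotC z). Qed.

Lemma dotZl c x y : dot (c *: x) y = c * dot x y.
Proof.
by rewrite /dot mulr_sumr; apply: eq_bigr => i _; rewrite mxE mulrA.
Qed.

Lemma dotZr c x y : dot y (c *: x) = c * dot y x.
Proof. by rewrite dotC dotZl dotC. Qed.

Lemma dotNl x y : dot (- x) y = - dot x y.
Proof. by rewrite -scaleN1r dotZl mulN1r. Qed.

Lemma dotNr x y : dot y (- x) = - dot y x.
Proof. by rewrite -scaleN1r dotZr mulN1r. Qed.

Lemma dot0l x : dot 0 x = 0.
Proof. by rewrite -(scale0r 0) dotZl mul0r. Qed.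

Lemma dot0r x : dot x 0 = 0.
Proof. by rewrite dotC dot0l. Qed.

Definition dotE := (dotDl, dotDr, dotNl, dotNr, dotZl, dotZr).

Lemma dot_ge0 x : 0 <= dot x x.
Proof. by apply: sumr_ge0 => i _; rewrite -expr2 sqr_ge0. Qed.

Lemma dot_eq0 x : dot x x = 0 -> x = 0.
Proof.
move=> /eqP; rewrite psumr_eq0; last by move=> i _; rewrite -expr2 sqr_ge0.
move=> /allP x0; apply/rowP => i; rewrite mxE.
have := x0 i (mem_index_enum _).
by rewrite -expr2 sqrf_eq0 => /eqP.
Qed.

Lemma enorm_ge0 x : 0 <= enorm x.
Proof. exact: sqrtr_ge0. Qed.

Lemma enorm_sqr x : enorm x ^+ 2 = dot x x.
Proof. by rewrite sqr_sqrtr// dot_ge0. Qed.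

Lemma enorm0 : enorm (0 : 'rV[R]_d) = 0.
Proof. by rewrite /enorm dot0l sqrtr0. Qed.

Lemma enorm_eq0 x : enorm x = 0 -> x = 0.
Proof. by move=> x0; apply: dot_eq0; rewrite -enorm_sqr x0 expr0n. Qed.

Lemma enormZ c x : enorm (c *: x) = `|c| * enorm x.
Proof. by rewrite /enorm !dotE mulrA -expr2 sqrtrM ?sqr_ge0// sqrtr_sqr. Qed.

Lemma enormN x : enorm (- x) = enorm x.
Proof. by rewrite /enorm dotNl dotNr opprK. Qed.

Lemma enormBC x y : enorm (x - y) = enorm (y - x).
Proof. by rewrite -enormN opprB. Qed.

Lemma cauchy_schwarz x y : dot x y <= enorm x * enorm y.
Proof.
have [x0|x0] := eqVneq (enorm x) 0.
  by rewrite (enorm_eq0 x0) dot0l enorm0 mul0r.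
have [y0|y0] := eqVneq (enorm y) 0.
  by rewrite (enorm_eq0 y0) dot0r enorm0 mulr0.
have xy0 : 0 < enorm x * enorm y.
  by rewrite mulr_gt0// lt_def ?x0 ?y0 enorm_ge0.
have := dot_ge0 (enorm y *: x - enorm x *: y).
rewrite !dotE (dotC y x) -!enorm_sqr => h.
have : (enorm x * enorm y) * dot x y <= (enorm x * enorm y) * (enorm x * enorm y).
  by nra.
by rewrite ler_pM2l.
Qed.

Lemma enormD x y : enorm (x + y) <= enorm x + enorm y.
Proof.
rewrite -(ler_pXn2r (n := 2)) ?nnegrE ?addr_ge0 ?enorm_ge0//.
rewrite enorm_sqr !dotE (dotC y x) -!enorm_sqr.
have := cauchy_schwarz x y; nra.
Qed.

Lemma enormB x y : enorm (x - y) <= enorm x + enorm y.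
Proof. by rewrite (le_trans (enormD _ _))// enormN. Qed.

Lemma enorm_le_of_dot x c : 0 <= c -> dot x x <= c * enorm x -> enorm x <= c.
Proof.
move=> c0; rewrite -enorm_sqr => h.
have [->//|x0] := eqVneq (enorm x) 0.
have xp : 0 < enorm x by rewrite lt_def x0 enorm_ge0.
by rewrite -(ler_pM2r xp) -expr2.
Qed.

Lemma norm_le_enorm x : `|x| <= enorm x.
Proof.
rewrite [leLHS](_ : _ = mx_norm x)//.
have [->|/mx_norm_neq0[[i j] ->/=]] := eqVneq (mx_norm x) 0.
  exact: enorm_ge0.
rewrite ord1 -sqrtr_sqr ler_sqrt ?dot_ge0// /dot (bigD1 j)//= expr2 lerDl.
by apply: sumr_ge0 => k _; rewrite -expr2 sqr_ge0.
Qed.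

Lemma row_sum_coord x : x = \sum_(i < d) x 0 i *: delta_mx 0 i.
Proof. exact: row_sum_delta. Qed.

Section Limits.
Variables (T : Type) (G : set_system T) (FG : Filter G).

Lemma cvg_dot (f g : T -> 'rV[R]_d) x y :
  f @ G --> x -> g @ G --> y -> (fun t => dot (f t) (g t)) @ G --> dot x y.
Proof.
move=> fx gy; rewrite /dot.
apply: cvg_big => [|i _]; first exact: add_continuous.
apply: cvgM.
  exact: (cvg_comp f (fun u : 'rV[R]_d => u 0 i) fx (@coord_continuous _ _ _ _ _ _)).
exact: (cvg_comp g (fun u : 'rV[R]_d => u 0 i) gy (@coord_continuous _ _ _ _ _ _)).
Qed.

Lemma cvg_enorm (f : T -> 'rV[R]_d) x :
  f @ G --> x -> (fun t => enorm (f t)) @ G --> enorm x.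
Proof.
move=> fx.
exact: (cvg_comp _ _ (cvg_dot fx fx) (@sqrt_continuous R _)).
Qed.

Lemma cvg_enormX (f : T -> 'rV[R]_d) x n :
  f @ G --> x -> (fun t => enorm (f t) ^+ n) @ G --> enorm x ^+ n.
Proof.
move=> fx; elim: n => [|n IH]; first exact: cvg_cst.
rewrite exprS; under eq_fun do rewrite exprS.
by apply: cvgM => //; exact: cvg_enorm.
Qed.

Lemma cvg_of_enorm (f : T -> 'rV[R]_d) x :
  (fun t => enorm (f t - x)) @ G --> 0 -> f @ G --> x.
Proof.
move=> /cvgrPdist_lt h; apply/cvgrPdist_lt => e e0.
have := h e e0; apply: filterS => t.
rewrite sub0r normrN ger0_norm ?enorm_ge0//.
by apply: le_lt_trans; rewrite enormBC norm_le_enorm.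
Qed.

End Limits.

(* Testing continuity along an abstract filter keeps unification away from the
   concrete neighbourhood filters of matrices. *)
Lemma continuous_along (U : topologicalType) (f : 'rV[R]_d -> U) :
  (forall (x : 'rV[R]_d) (T : Type) (G : set_system T) (g : T -> 'rV[R]_d),
     Filter G -> g @ G --> x -> (fun t => f (g t)) @ G --> f x) ->
  continuous f.
Proof. by move=> h x; apply: (h x _ (nbhs x) id). Qed.

(** Compactness of closed balls, phrased through continuous test functions so that no subsequence is
    extracted: a single [l] serves every [g] and every [C]. *)
Lemma bounded_cluster (x : nat -> 'rV[R]_d) (K : R) :
  (forall n, enorm (x n) <= K) ->
  exists l : 'rV[R]_d, forall g : 'rV[R]_d -> R, continuous g ->
    forall C : R, (forall n, - (C / n.+1%:R) <= g (x n)) -> 0 <= g l.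
Proof.
move=> xK.
have cK : compact [set v : 'rV[R]_d | `|v| <= K].
  apply: bounded_closed_compact.
    exists K; split; first exact: num_real.
    by move=> M KM v /= vK; rewrite (le_trans vK)// ltW.
  have -> : [set v : 'rV[R]_d | `|v| <= K] =
            (fun v : 'rV[R]_d => `|v|) @^-1` [set r | r <= K] by [].
  apply: preimage_closed; last exact: closed_le.
  by move=> v _; exact: norm_continuous.
have [|l [_ cl]] := cK (x @ \oo) _.
  by exists 0%N => // n _ /=; rewrite (le_trans (norm_le_enorm _)).
exists l => g cg C gx; rewrite leNgt; apply/negP => gl0.
have : \forall v \near l, g v < g l / 2.
  by move/cvgr_lt : (cg l); apply; lra.
move=> /(cl _ _ _)/=.
have e0 : 0 < - (g l / 2) by lra.
have : (x @ \oo) [set v | g l / 2 < g v].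
  have : (fun n : nat => - C * n.+1%:R^-1) @ \oo --> - C * 0.
    by apply: cvgM; [exact: cvg_cst|exact: cvg_harmonic].
  rewrite mulr0 => /cvgrPdist_lt/(_ _ e0) h.
  rewrite /= /fmap/=; near=> n.
  rewrite /= (lt_le_trans _ (gx n))//.
  have : `|0 - - C * n.+1%:R^-1| < - (g l / 2) by near: n.
  rewrite sub0r mulNr opprK ltr_norml => /andP[_].
  by rewrite ltrNr.
move=> h1 h2; have [v [/= + +]] := h2 _ h1.
by move=> /lt_trans h /h; rewrite ltxx.
Unshelve. all: by end_near. Qed.

End Euclidean.

(** * Monotone operators: Minty's theorem, resolvents, sums with a continuous monotone map *)

Section MaximalMonotone.
Variables (R : realType) (d : nat).
Implicit Types (a mu : R) (x y z u v w h : 'rV[R]_d) (G H : 'rV[R]_d -> set 'rV[R]_d).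

(** The third entry is interpolated linearly, so on mixtures it is in general different from
    [<h, u>]. *)
Inductive conv_graph G : 'rV[R]_d -> 'rV[R]_d -> R -> Prop :=
| Conv_point u h : G u h -> conv_graph G u h (dot h u)
| Conv_mix t u h s u' h' s' : 0 <= t <= 1 ->
    conv_graph G u h s -> conv_graph G u' h' s' ->
    conv_graph G ((1 - t) *: u + t *: u') ((1 - t) *: h + t *: h')
      ((1 - t) * s + t * s').

(** The expression is affine in each triple separately, and on two graph points it equals
    [<v1 - v2, x1 - x2>]. With both triples equal it says [s >= <v, x>]. *)
Lemma conv_graph_monotone G x1 v1 s1 x2 v2 s2 : monotone_op G ->
  conv_graph G x1 v1 s1 -> conv_graph G x2 v2 s2 ->
  0 <= s1 + s2 - dot v1 x2 - dot v2 x1.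
Proof.
move=> mG; elim=> [u h Guh|t u h s u' h' s' /andP[t0 t1] _ + _ + c2].
  elim=> [u' h' Guh'|t u1 h1 s1' u' h' s' /andP[t0 t1] _ + _ +].
    by have := mG _ _ _ _ Guh Guh'; rewrite !dotE; lra.
  rewrite !dotE => a1 a2; nra.
by move=> /(_ c2) + /(_ c2); rewrite !dotE => a1 a2; nra.
Qed.

(* Minty's theorem. The point [x] is the limit of a minimizing sequence of
   [s + |(u - v) / 2|^2] over the convex hull of the triples [(u, v, <v, u>)],
   [v \in G u]. *)
Lemma minty G : monotone_op G ->
  exists x, forall u h, G u h -> 0 <= dot (h + x) (u - x).
Proof.
move=> mG; have [[u0 [h0 Guh0]]|nG] := pselect (exists u h, G u h); last first.
  by exists 0 => u h Guh; case: nG; exists u, h.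
pose mid u h : 'rV[R]_d := 2^-1 *: (u - h).
pose Q := [set q | exists u h s, conv_graph G u h s /\
                     q = s + dot (mid u h) (mid u h)].
have Q_ge0 q : Q q -> 0 <= q.
  move=> [u [h [s [c ->]]]].
  have := conv_graph_monotone mG c c; have := dot_ge0 (u + h).
  by rewrite /mid !dotE (dotC h u); lra.
have Q0 : Q !=set0 by exists (dot h0 u0 + dot (mid u0 h0) (mid u0 h0));
  exists u0, h0, (dot h0 u0); split=> //; exact: Conv_point.
have iQ : has_inf Q by split=> //; exists 0 => q /Q_ge0.
pose m := inf Q.
have m_ge0 : 0 <= m by apply: lb_le_inf => // q /Q_ge0.
have m_conv u h s : conv_graph G u h s -> m <= s + dot (mid u h) (mid u h).
  by move=> c; apply: (ge_inf iQ.2); exists u, h, s.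
have /choice[X hX] n : exists x, exists u h s,
    [/\ conv_graph G u h s, x = mid u h & s + dot x x < m + n.+1%:R^-1].
  have e0 : 0 < n.+1%:R^-1 :> R by rewrite invr_gt0.
  have [_ [u [h [s [c ->]]]] lt_q] := inf_adherent e0 iQ.
  by exists (mid u h), u, h, s.
pose q u h := dot h u + dot (mid u h) (mid u h).
(* Mixing a near-minimizer with a graph point at weight [t] cannot fall below [m]; the last term is
   the convexity defect of the square. *)
have key n u h (t : R) : G u h -> 0 < t <= 1 ->
    - (1 / n.+1%:R) <= t * (q u h - m)
      - t * (1 - t) * dot (X n - mid u h) (X n - mid u h).
  move=> Guh /andP[t0 t1]; have [un [hn [sn [c Xn lt_q]]]] := hX n.
  have t01 : 0 <= t <= 1 by rewrite ltW.
  have := Conv_mix t01 c (Conv_point Guh) => /m_conv.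
  have -> : mid ((1 - t) *: un + t *: u) ((1 - t) *: hn + t *: h) =
            (1 - t) *: X n + t *: mid u h.
    by rewrite Xn /mid; apply/rowP => i; rewrite !mxE; ring.
  have := invr_gt0 (n.+1%:R : R); rewrite ltr0Sn => i0.
  rewrite /q div1r; set r := n.+1%:R^-1 in lt_q i0 *.
  have p0 : 0 <= (1 - t) * (m + r - (sn + dot (X n) (X n))).
    by rewrite mulr_ge0 ?subr_ge0// ltW.
  move: (mid u h) (X n) p0 => w x; rewrite !dotE (dotC w x); nra.
have n_le1 n : n.+1%:R^-1 <= 1 :> R by rewrite invf_le1 ?ler1n.
have [|l hl] := @bounded_cluster _ _ X
    (3 + (q u0 h0 - m) + enorm (mid u0 h0)).
  move=> n; rewrite -[X n](subrK (mid u0 h0)).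
  apply: le_trans (enormD _ _) _; rewrite lerD2r.
  have h2 : 0 < (2^-1 : R) <= 1 by lra.
  have := key n _ _ _ Guh0 h2; have := n_le1 n; rewrite -enorm_sqr div1r.
  move: (enorm _) (q _ _ - m) (n.+1%:R^-1) => e c r; nra.
exists l => u h Guh.
have {}hl (t : R) : 0 < t <= 1 ->
    0 <= t * (q u h - m) - t * (1 - t) * dot (l - mid u h) (l - mid u h).
  move=> t01; apply: (hl (fun x => t * (q u h - m) -
    t * (1 - t) * dot (x - mid u h) (x - mid u h))) (1) _ => [|n].
    apply: continuous_along => x T F g FF gx.
    apply: cvgB; first exact: cvg_cst.
    by apply: cvgMl_tmp; apply: cvg_dot; apply: cvgB => //; exact: cvg_cst.
  exact: key.
suff : dot (l - mid u h) (l - mid u h) <= q u h - m.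
  by rewrite /q /mid !dotE (dotC u l) (dotC h l) (dotC h u); lra.
rewrite leNgt; apply/negP.
set b := dot _ _ in hl *; set c := q u h - m in hl * => cb.
have c0 : 0 <= c by have := hl 1; rewrite ltr01 lexx => /(_ isT); lra.
have b0 : 0 < b by lra.
(* For this [t], [(1 - t) b = (b + c) / 2 > c], which does the work of the limit [t -> 0]. *)
have t0 : 0 < (b - c) / (2 * b) <= 1.
  by rewrite divr_gt0 ?subr_gt0 ?mulr_gt0//= ler_pdivrMr ?mulr_gt0//; lra.
have := hl _ t0; set t := _ / _ in t0 *.
have tb : t * b = (b - c) / 2 by rewrite /t; field; rewrite gt_eqF.
have /andP[t00 _] := t0; nra.
Qed.

(** Adding the pair [(x, v)] to the graph keeps it monotone, so maximality forces the pair into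
    [H]. *)
Lemma maximal_monotoneP H x v : maximal_monotone H ->
  (forall u h, H u h -> 0 <= dot (h - v) (u - x)) -> H x v.
Proof.
move=> [mH maxH] xv.
pose G y := [set w | H y w \/ (y = x /\ w = v)].
apply: (maxH G) (or_intror (conj erefl erefl)) => [y z u w|y w]; last by left.
move=> [Hyu|[-> ->]] [Hzw|[-> ->]]; first exact: mH.
- exact: xv.
- by rewrite -opprB dotNl -[x - z]opprB dotNr opprK; exact: xv.
- by rewrite subrr dot0l.
Qed.

(** Minty's theorem for [mu H - x]; its inequality divided by [mu] is the criterion of
    [maximal_monotoneP]. *)
Lemma resolvent H mu x : maximal_monotone H -> 0 < mu ->
  exists z, H z (mu^-1 *: (x - z)).
Proof.
move=> mH mu0.
pose G y := [set w | exists2 h, H y h & w = mu *: h - x].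
have mG : monotone_op G.
  move=> y z _ _ [u Hu ->] [v Hv ->]; have := mH.1 _ _ _ _ Hu Hv.
  have -> : mu *: u - x - (mu *: v - x) = mu *: (u - v).
    by rewrite scalerBr; apply/rowP => i; rewrite !mxE; ring.
  by rewrite dotZl => ?; rewrite mulr_ge0// ltW.
have [z hz] := minty mG; exists z; apply: maximal_monotoneP => // u h Huh.
have /hz : G u (mu *: h - x) by exists h.
have -> : mu *: h - x + z = mu *: (h - mu^-1 *: (x - z)).
  by rewrite scalerBr scalerA divff ?gt_eqF// scale1r opprB addrA addrAC -addrA.
by rewrite dotZl pmulr_rge0.
Qed.

(** Minty's inequality is tested at [x - t e], where [e] is the residual of the equation at [x];
    dividing by [t] and letting [t -> 0] gives [- |e|^2 >= 0]. *)
Lemma continuous_monotone_surjective (B : 'rV[R]_d -> 'rV[R]_d) y :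
  monotone_map B -> continuous B -> exists x, B x + x = y.
Proof.
move=> mB cB.
have [u0 v0 u w -> ->|x hx] := @minty (fun u => [set B u - y]).
  by rewrite opprB addrA subrK; exact: mB.
exists x; apply/eqP; rewrite -subr_eq0; apply/eqP/dot_eq0/eqP.
rewrite eq_le dot_ge0 andbT -oppr_ge0.
set e : 'rV[R]_d := B x + x - y.
have h (t : R) : 0 < t -> 0 <= - dot (B (x - t *: e) - y + x) e.
  move=> t0; have := hx (x - t *: e) _ erefl.
  by rewrite [x - _ - x]addrAC subrr sub0r dotNr dotZr -mulrN pmulr_rge0.
have c : (fun n : nat => - dot (B (x - n.+1%:R^-1 *: e) - y + x) e) @ \oo -->
    - dot (B (x - (0 : R) *: e) - y + x) e.
  apply: cvgN; apply: cvg_dot; last exact: cvg_cst.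
  apply: cvgD; last exact: cvg_cst.
  apply: cvgB; last exact: cvg_cst.
  apply: (continuous_cvg _ (cB _)).
  apply: cvgB; first exact: cvg_cst.
  by apply: cvgZr_tmp; exact: cvg_harmonic.
move: c; rewrite scale0r subr0 (_ : B x - y + x = e); last first.
  by rewrite /e addrAC.
move=> c; have <- := cvg_lim (@Rhausdorff R) c.
by apply: limr_ge; [apply: cvgP c|near=> n; apply: h; rewrite invr_gt0].
Unshelve. all: by end_near. Qed.

(* The Yosida approximations of [H] with parameters [1 / n] are continuous, so
   the equation with [H] replaced by them is solvable; the solutions stay
   bounded. *)
Lemma monotone_sum_solvable H (T : 'rV[R]_d -> 'rV[R]_d) a y :
  maximal_monotone H -> (exists u, op_dom H u) ->
  monotone_map T -> continuous T -> 0 < a ->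
  exists z, H z (a^-1 *: (y - z) - T z).
Proof.
move=> mH [u0 [h0 Hu0]] mT cT a0.
pose mu n : R := n.+1%:R^-1.
have mu0 n : 0 < mu n by rewrite /mu invr_gt0.
have mu1 n : mu n <= 1 by rewrite invf_le1 ?ler1n.
have /choice[J hJ] n : exists J, forall x, H (J x) ((mu n)^-1 *: (x - J x)).
  by have [J hJ] := choice (fun x => resolvent x mH (mu0 n)); exists J.
pose Y n x : 'rV[R]_d := (mu n)^-1 *: (x - J n x).
have JY n x : J n x = x - mu n *: Y n x.
  by rewrite /Y scalerA divff ?gt_eqF// scale1r opprB addrC subrK.
have mY n : monotone_map (Y n).
  move=> x z; have := mH.1 _ _ _ _ (hJ n x) (hJ n z).
  rewrite -/(Y n x) -/(Y n z) {1}JY {1}(JY n z).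
  have := dot_ge0 (Y n x - Y n z).
  have -> : x - mu n *: Y n x - (z - mu n *: Y n z) =
    (x - z) - mu n *: (Y n x - Y n z).
    by rewrite scalerBr; apply/rowP => i; rewrite !mxE; ring.
  rewrite [in X in _ -> X -> _]dotDr dotNr dotZr => h1 h2.
  by rewrite (le_trans _ (le_trans h2 _))// lerBlDr lerDl mulr_ge0// ltW.
have cY n : continuous (Y n).
  have lip x z : enorm (Y n z - Y n x) <= (mu n)^-1 * enorm (z - x).
    apply: enorm_le_of_dot.
      by rewrite mulr_ge0 ?invr_ge0 ?enorm_ge0// ltW.
    rewrite -mulrA mulrC ler_pdivlMr//.
    have := mH.1 _ _ _ _ (hJ n z) (hJ n x).
    rewrite -/(Y n z) -/(Y n x) {1}JY {1}(JY n x).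
    have -> : z - mu n *: Y n z - (x - mu n *: Y n x) =
      (z - x) - mu n *: (Y n z - Y n x).
      by rewrite scalerBr; apply/rowP => i; rewrite !mxE; ring.
    rewrite dotDr dotNr dotZr subr_ge0 mulrC => /le_trans; apply.
    by rewrite mulrC; exact: cauchy_schwarz.
  apply: continuous_along => x S F g FF gx; apply: cvg_of_enorm.
  apply: (@squeeze_cvgr _ _ _ _ (cst 0) (fun t => (mu n)^-1 * enorm (g t - x))).
  - by near=> t; rewrite enorm_ge0 lip.
  - exact: cvg_cst.
  - rewrite -[X in _ --> X](mulr0 (mu n)^-1) -(enorm0 R d) -(subrr x).
    by apply: cvgMl_tmp; apply: cvg_enorm; apply: cvgB => //; exact: cvg_cst.
have solve n : exists z, a *: (T z + Y n z) + z = y.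
  apply: (@continuous_monotone_surjective (fun z => a *: (T z + Y n z))) => [x z|].
    rewrite -scalerBr dotZl; apply: (mulr_ge0 (ltW a0)).
    have -> : T x + Y n x - (T z + Y n z) = (T x - T z) + (Y n x - Y n z).
      by rewrite opprD addrACA.
    by rewrite dotDl; apply: addr_ge0; [exact: mT|exact: mY].
  apply: continuous_along => x S F g FF gx; apply: cvgZl_tmp; apply: cvgD.
    exact: (cvg_comp _ _ gx (cT x)).
  exact: (cvg_comp _ _ gx (cY n x)).
have /choice[Z hZ] := solve.
pose V z : 'rV[R]_d := a^-1 *: (y - z) - T z.
have YV n : Y n (Z n) = V (Z n).
  rewrite /V -{1}(hZ n) addrK scalerA mulVf ?gt_eqF// scale1r addrC addKr//.
(* Passing from the resolvent point to [Z n] costs [mu n] times [<V - h, V>], which is at least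
   [- |h|^2 / 4] by completing the square. *)
have key n u h : H u h ->
    - ((dot h h / 4) / n.+1%:R) <= dot (V (Z n) - h) (Z n - u).
  move=> Huh; have := mH.1 _ _ _ _ (hJ n (Z n)) Huh.
  rewrite -/(Y n (Z n)) JY YV -/(mu n).
  have := dot_ge0 (V (Z n) - 2^-1 *: h).
  move: (mu n) (mu0 n) (Z n) (V (Z n)) => m m0 z w.
  rewrite !dotE (dotC h w); nra.
(* [- V] is strongly monotone with constant [1 / a]; with [key] this bounds the sequence [Z]. *)
have VT z u h : dot (V z - h) (z - u) <=
    dot (a^-1 *: (y - u) - T u - h) (z - u) - a^-1 * dot (z - u) (z - u).
  have := mT z u.
  have -> : V z - h = (a^-1 *: (y - u) - T u - h) - a^-1 *: (z - u) - (T z - T u).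
    by rewrite /V; apply/rowP => i; rewrite !mxE; ring.
  move: (a^-1 *: (y - u) - _ - _) (z - u) (T z - T u) => p q r.
  by rewrite !dotE; lra.
pose p : 'rV[R]_d := a^-1 *: (y - u0) - T u0 - h0.
have [|l hl] := @bounded_cluster _ _ Z
    (1 + a * (enorm p + dot h0 h0 / 4) + enorm u0).
  move=> n; rewrite -[Z n](subrK u0).
  apply: le_trans (enormD _ _) _; rewrite lerD2r.
  have := le_trans (key n _ _ Hu0) (VT (Z n) u0 h0).
  rewrite -/p -/(mu n) -[dot (Z n - u0) (Z n - u0)]enorm_sqr => k1.
  have k2 := cauchy_schwarz p (Z n - u0).
  set e := enorm (Z n - u0) in k1 k2 *; have e0 : 0 <= e := enorm_ge0 _.
  have := enorm_ge0 p; have := dot_ge0 h0; have := mu1 n; have := mu0 n.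
  set c := dot h0 h0 in k1 *; set P := enorm p in k2 *; set D := dot p _ in k1 k2.
  move=> m0 m1 c0 P0.
  have k3 : a^-1 * e ^+ 2 <= P * e + c / 4 by nra.
  have k4 : e ^+ 2 <= a * (P * e + c / 4) by rewrite mulrC -ler_pdivrMr// mulrC.
  have [e1|e1] := leP e 1; first by nra.
  have ac : 0 <= a * c * (e - 1) by rewrite !mulr_ge0 ?subr_ge0// ltW.
  have k5 : e * e <= (a * (P + c / 4)) * e by lra.
  have : e <= a * (P + c / 4) by rewrite -(ler_pM2r (lt_trans ltr01 e1)).
  lra.
exists l; apply: maximal_monotoneP => // u h Huh; rewrite -/(V l).
have -> : dot (h - V l) (u - l) = dot (V l - h) (l - u).
  by rewrite -opprB dotNl -[u - l]opprB dotNr opprK.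
apply: (hl (fun x => dot (V x - h) (x - u))) (dot h h / 4) _ => [|n].
  apply: continuous_along => x S F g FF gx.
  apply: cvg_dot; last by apply: cvgB => //; exact: cvg_cst.
  apply: cvgB; last exact: cvg_cst.
  apply: cvgB; last exact: (cvg_comp _ _ gx (cT x)).
  by apply: cvgZl_tmp; apply: cvgB => //; exact: cvg_cst.
exact: key.
Unshelve. all: by end_near. Qed.

End MaximalMonotone.

(** * One-variable calculus: a one-sided Taylor inequality *)

Section RealCalculus.
Variable R : realType.
Implicit Types (f df : R -> R) (s t K : R).

Lemma mean_value f df s : 0 < s -> (forall t, is_derive t 1 f (df t)) ->
  exists2 c : R, 0 < c < s & f s - f 0 = df c * s.
Proof.
move=> s0 fd; have [|c cs e] := @MVT R f df 0 s s0 (fun t _ => fd t).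
  by apply: derivable_within_continuous => t _; apply: ex_derive.
by exists c; [rewrite in_itv in cs|rewrite e subr0].
Qed.

(** Induction on [n]: the difference of the two sides vanishes at 0, and its derivative is the same
    difference for the shifted family. The top function [f n] is never differentiated, since only a
    Lipschitz bound is available for it. *)
Lemma taylor_upper n (f : nat -> R -> R) K :
  (forall i t, (i < n)%N -> is_derive t 1 (f i) (f i.+1 t)) ->
  (forall t, 0 <= t <= 1 -> f n t - f n 0 <= K * t) ->
  forall t, 0 <= t <= 1 ->
  f 0%N t - \sum_(i < n.+1) (i`!%:R)^-1 * (f i 0) * t ^+ i
    <= K / n.+1`!%:R * t ^+ n.+1.
Proof.
elim: n f => [|n IH] f fd fK t t01.
  rewrite big_ord1 /= factS fact0 muln1 expr0 expr1 invr1 !mulr1 mul1r.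
  exact: fK.
have [->|t_neq0] := eqVneq t 0.
  rewrite big_ord_recl big1 => [|i _]; last by rewrite expr0n mulr0.
  by rewrite !expr0n /= mulr0 addr0 mulr1 invr1 mul1r subrr.
have t0 : 0 < t by rewrite lt_def t_neq0; case/andP: t01.
pose g s := f 0%N s - \sum_(i < n.+2) (i`!%:R)^-1 * (f i 0) * s ^+ i
  - K / n.+2`!%:R * s ^+ n.+2.
pose dg s := f 1%N s - \sum_(i < n.+1) (i`!%:R)^-1 * (f i.+1 0) * s ^+ i
  - K / n.+1`!%:R * s ^+ n.+1.
have fact_neq0 (i : nat) : i`!%:R != 0 :> R by rewrite pnatr_eq0 -lt0n fact_gt0.
have gd s : is_derive s 1 g (dg s).
  have dX (c : R) (i : nat) :
      is_derive s 1 (fun x : R => c * x ^+ i) (c * (i%:R * s ^+ i.-1)).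
    have dXi := DeriveDef (@exprn_derivable R i s 1) (@exp_derive R i s 1).
    have := @is_deriveZ _ _ _ _ c _ _ _ dXi.
    by move/is_derive_eq; apply; rewrite /GRing.scale/= mulr1.
  have dS : is_derive s 1
      (\sum_(i < n.+2) (fun x : R => ((i`!%:R)^-1 * f i 0) * x ^+ i))
      (\sum_(i < n.+2) ((i`!%:R)^-1 * f i 0 * (i%:R * s ^+ i.-1))).
    by apply: is_derive_sum => i; exact: dX.
  have := is_deriveB (is_deriveB (fd 0%N s isT) dS) (dX (K / n.+2`!%:R) n.+2).
  have -> : f 0%N - \sum_(i < n.+2) (fun x : R => ((i`!%:R)^-1 * f i 0) * x ^+ i) -
      (fun x => K / n.+2`!%:R * x ^+ n.+2) = g.
    by rewrite fct_sumE.
  move/is_derive_eq; apply; rewrite /dg; congr (_ - _ - _).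
    rewrite big_ord_recl /= mul0r mulr0 add0r; apply: eq_bigr => i _.
    rewrite /bump leq0n /= add1n factS natrM; field.
    by rewrite fact_neq0 nat1r pnatr_eq0.
  rewrite /= (factS n.+1) natrM; field.
  by rewrite fact_neq0 -(natrD _ 2) pnatr_eq0.
have [c /andP[c0 ct] e] := mean_value t0 gd.
have : dg c <= 0.
  rewrite subr_le0; apply: (IH (fun i => f i.+1)) => [i x ilt|x x01|].
  - exact: fd.
  - exact: fK.
  - by rewrite ltW//= (le_trans (ltW ct))//; case/andP: t01.
move=> /(mulr_le0_ge0)/(_ (ltW t0)); rewrite -e.
have -> : g 0 = 0.
  rewrite /g big_ord_recl big1 => [|i _]; last by rewrite expr0n mulr0.
  by rewrite !expr0n /= mulr0 addr0 mulr1 invr1 mul1r subrr subr0.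
by rewrite subr0 /g subr_le0.
Qed.

Lemma convex_expn n s (x y : R) : 0 <= s <= 1 -> 0 <= x -> 0 <= y ->
  ((1 - s) * x + s * y) ^+ n <= (1 - s) * x ^+ n + s * y ^+ n.
Proof.
move=> /andP[s0 s1] x0 y0; elim: n => [|n IH]; first by rewrite !expr0; lra.
have s1' : 0 <= 1 - s by rewrite subr_ge0.
rewrite exprS; apply: le_trans (ler_wpM2l _ IH) _.
  by rewrite addr_ge0 ?mulr_ge0.
rewrite -subr_ge0.
have -> : (1 - s) * x ^+ n.+1 + s * y ^+ n.+1 -
    ((1 - s) * x + s * y) * ((1 - s) * x ^+ n + s * y ^+ n) =
    s * (1 - s) * ((x - y) * (x ^+ n - y ^+ n)) by rewrite !exprS; ring.
apply: mulr_ge0; [exact: mulr_ge0|have [xy|/ltW yx] := leP x y].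
  by rewrite mulr_le0 ?subr_le0 ?lerXn2r.
by rewrite mulr_ge0 ?subr_ge0 ?lerXn2r.
Qed.

End RealCalculus.

(** * Derivatives along lines and symmetry of second derivatives *)

Section DirectionalDerivatives.
Variables (R : realType) (d : nat).
Implicit Types (g F : 'rV[R]_d -> 'rV[R]_d) (a b e u v w z : 'rV[R]_d) (s t c : R).

Lemma is_derive_line g z w e t : differentiable g (z + t *: w) ->
  is_derive t 1 (fun s => dot (g (z + s *: w)) e)
    (dot ('d g (z + t *: w) w) e).
Proof.
move=> dg.
have c : (fun h : R => h^-1 *: (((fun s => dot (g (z + s *: w)) e) \o shift t)
    (h *: 1) - dot (g (z + t *: w)) e)) @ 0^' --> dot ('d g (z + t *: w) w) e.
  have -> : (fun h : R => h^-1 *: (((fun s => dot (g (z + s *: w)) e) \o shift t)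
      (h *: 1) - dot (g (z + t *: w)) e)) = (fun h : R =>
      dot (h^-1 *: ((g \o shift (z + t *: w)) (h *: w) - g (z + t *: w))) e).
    apply/funext => h /=; rewrite dotZl dotDl dotNl; congr (_ *: (dot (g _) e - _)).
    by rewrite [h *: 1]mulr1 scalerDl addrCA.
  apply: cvg_dot; last exact: cvg_cst.
  by rewrite -(deriveE w dg); exact: diff_derivable.
by apply: DeriveDef; [apply: cvgP c|exact: (cvg_lim (@Rhausdorff R) c)].
Qed.

(* Schwarz's theorem, from two applications of the mean value theorem to the
   second difference of [g] in each order. *)
Lemma second_difference g a b e z s : 0 < s ->
  (forall x, differentiable g x) ->
  (forall x, differentiable (fun y => 'd g y a) x) ->
  exists c1 c2, [/\ 0 < c1 < s, 0 < c2 < s &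
    dot (g (z + s *: a + s *: b) - g (z + s *: a) - g (z + s *: b) + g z) e =
    dot ('d (fun y => 'd g y a) (z + c1 *: a + c2 *: b) b) e * s * s].
Proof.
move=> s0 dg dga.
pose f t := dot (g (z + s *: b + t *: a)) e - dot (g (z + t *: a)) e.
have fd t : is_derive t 1 f
    (dot ('d g (z + s *: b + t *: a) a) e - dot ('d g (z + t *: a) a) e).
  exact: (is_deriveB (is_derive_line e (dg (z + s *: b + t *: a)))
                     (is_derive_line e (dg (z + t *: a)))).
have [c1 c1s e1] := mean_value s0 fd.
have hd t := is_derive_line e (dga (z + c1 *: a + t *: b)).
have [c2 c2s e2] := mean_value s0 hd.
exists c1, c2; split=> //; rewrite -e2 scale0r addr0.
rewrite [z + c1 *: a + s *: b]addrAC -e1 /f !scale0r !addr0.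
by rewrite [z + s *: b + s *: a]addrAC !dotE; ring.
Qed.

Lemma cvg_line2 z a b (x y : nat -> R) :
  (forall n, 0 < x n < n.+1%:R^-1) -> (forall n, 0 < y n < n.+1%:R^-1) ->
  (fun n => z + x n *: a + y n *: b) @ \oo --> z.
Proof.
move=> hx hy; have sq (u : nat -> R) : (forall n, 0 < u n < n.+1%:R^-1) ->
    u @ \oo --> 0.
  move=> hu; apply: (@squeeze_cvgr _ _ _ _ (cst 0) (fun n => n.+1%:R^-1)).
  - by near=> n; case/andP: (hu n) => /ltW -> /ltW ->.
  - exact: cvg_cst.
  - exact: cvg_harmonic.
suff : (fun n => z + x n *: a + y n *: b) @ \oo --> z + 0 *: a + 0 *: b.
  by rewrite !scale0r !addr0.
apply: cvgD; last by apply: cvgZr_tmp; exact: sq.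
by apply: cvgD; [exact: cvg_cst|apply: cvgZr_tmp; exact: sq].
Unshelve. all: by end_near. Qed.

Lemma schwarz_symmetry g a b z :
  (forall x, differentiable g x) ->
  (forall x, differentiable (fun y => 'd g y a) x) ->
  (forall x, differentiable (fun y => 'd g y b) x) ->
  continuous (fun y => 'd (fun x => 'd g x a) y b) ->
  continuous (fun y => 'd (fun x => 'd g x b) y a) ->
  'd (fun x => 'd g x a) z b = 'd (fun x => 'd g x b) z a.
Proof.
move=> dg da db cab cba; apply/eqP; rewrite -subr_eq0; apply/eqP/dot_eq0.
(* Testing against the difference [e] itself reduces the claim to equality of two scalars, where the
   mean value theorem applies. *)
set e := _ - _; rewrite {1}/e dotDl dotNl; apply/eqP; rewrite subr_eq0; apply/eqP.
have s0 n : 0 < n.+1%:R^-1 :> R by rewrite invr_gt0.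
have /choice[x hx] n := second_difference b e z (s0 n) dg da.
have /choice[x' hx'] := hx.
have /choice[y hy] n := second_difference a e z (s0 n) dg db.
have /choice[y' hy'] := hy.
have e12 n : dot ('d (fun y => 'd g y a) (z + x n *: a + x' n *: b) b) e =
             dot ('d (fun y => 'd g y b) (z + y n *: b + y' n *: a) a) e.
  have [_ _ h1] := hx' n; have [_ _ h2] := hy' n.
  have sn0 : n.+1%:R^-1 != 0 :> R by rewrite gt_eqF.
  apply: (mulIf sn0); apply: (mulIf sn0); rewrite -h1 -h2; congr (dot _ e).
  by rewrite [z + _ *: b + _]addrAC; apply/rowP => i; rewrite !mxE; ring.
have c1 : (fun n => dot ('d (fun y => 'd g y a) (z + x n *: a + x' n *: b) b) e)
    @ \oo --> dot ('d (fun y => 'd g y a) z b) e.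
  apply: cvg_dot; last exact: cvg_cst.
  have l1 : (fun n => z + x n *: a + x' n *: b) @ \oo --> z.
    by apply: cvg_line2 => n; have [] := hx' n.
  exact: (cvg_comp _ _ l1 (cab z)).
have c2 : (fun n => dot ('d (fun y => 'd g y b) (z + y n *: b + y' n *: a) a) e)
    @ \oo --> dot ('d (fun y => 'd g y b) z a) e.
  apply: cvg_dot; last exact: cvg_cst.
  have l2 : (fun n => z + y n *: b + y' n *: a) @ \oo --> z.
    by apply: cvg_line2 => n; have [] := hy' n.
  exact: (cvg_comp _ _ l2 (cba z)).
rewrite -(cvg_lim (@Rhausdorff R) c1) -(cvg_lim (@Rhausdorff R) c2).
by rewrite (funext e12).
Qed.

End DirectionalDerivatives.

(** * Derivative of a power of a symmetric multilinear map *)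

Section SymmetricMultilinear.
Variables (R : realType) (d k : nat) (D : seq 'rV[R]_d -> 'rV[R]_d).
Implicit Types (l : seq 'rV[R]_d).
Hypothesis D_linear : forall l1 l2 (c : R) (u v : 'rV[R]_d), (size l1 + size l2 < k)%N ->
  D (l1 ++ (c *: u + v) :: l2) = c *: D (l1 ++ u :: l2) + D (l1 ++ v :: l2).
Hypothesis D_swap : forall l1 l2 (a b : 'rV[R]_d), (size l2 + 2 <= k)%N ->
  D (l1 ++ a :: b :: l2) = D (l1 ++ b :: a :: l2).

Lemma nseq_catS i (w : 'rV[R]_d) l : nseq i.+1 w ++ l = nseq i w ++ w :: l.
Proof. by elim: i => //= i <-. Qed.

Lemma multilinear_slot i l1 (w h : 'rV[R]_d) s l : (i + size l < k)%N -> size l1 = i ->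
  D (l1 ++ (w + s *: h) :: l) = D (l1 ++ w :: l) + s *: D (l1 ++ h :: l).
Proof. by move=> lk sl; rewrite addrC D_linear ?sl// addrC. Qed.

(** Product rule, splitting one copy of [w + t h] off the power; the split copy joins [l], hence the
    induction over all [l]. Symmetry then merges the terms. *)
Lemma is_derive_power i l (w h e : 'rV[R]_d) (s : R) : (i + size l <= k)%N ->
  is_derive s 1 (fun t => dot (D (nseq i (w + t *: h) ++ l)) e)
    (i%:R * dot (D (nseq i.-1 (w + s *: h) ++ h :: l)) e).
Proof.
elim: i l => [|i IH] l lk.
  by rewrite mul0r /=; exact: is_derive_cst.
have ik : (i + size l < k)%N by rewrite addSn in lk.
have split (t : R) : dot (D (nseq i.+1 (w + t *: h) ++ l)) e =
    dot (D (nseq i (w + t *: h) ++ w :: l)) e +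
    t * dot (D (nseq i (w + t *: h) ++ h :: l)) e.
  by rewrite nseq_catS (multilinear_slot (i := i)) ?size_nseq// dotDl dotZl.
have lk' u : (i + size (u :: l) <= k)%N by rewrite /= addnS.
have d1 := IH _ (lk' w); have d2 := IH _ (lk' h).
have -> : (fun t : R => dot (D (nseq i.+1 (w + t *: h) ++ l)) e) =
    (fun t => dot (D (nseq i (w + t *: h) ++ w :: l)) e) +
    id * (fun t => dot (D (nseq i (w + t *: h) ++ h :: l)) e).
  by apply/funext => t; rewrite split.
apply: (is_derive_eq (is_deriveD d1 (is_deriveM (is_derive_id s 1) d2))).
suff : i%:R * dot (D (nseq i.-1 (w + s *: h) ++ h :: w :: l)) e +
    (s * (i%:R * dot (D (nseq i.-1 (w + s *: h) ++ h :: h :: l)) e) +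
    dot (D (nseq i (w + s *: h) ++ h :: l)) e * 1) =
    i.+1%:R * dot (D (nseq i.+1.-1 (w + s *: h) ++ h :: l)) e by [].
rewrite mulr1 -[in RHS]natr1 mulrDl mul1r addrA; congr (_ + _).
case: i ik {IH lk lk' split d1 d2} => [|i] ik.
  by rewrite !mul0r mulr0 addr0.
rewrite mulrCA -mulrDr; congr (_ * _); rewrite /=.
have -> : w + s *: h :: nseq i (w + s *: h) ++ h :: l =
    nseq i (w + s *: h) ++ (w + s *: h) :: h :: l by rewrite -nseq_catS.
rewrite -dotZl -dotDl.
rewrite [in RHS](multilinear_slot (i := i)) ?size_nseq ?addnS//.
by rewrite (D_swap _ h w)// addn2 (leq_trans _ ik)// !ltnS leq_addl.
Qed.

End SymmetricMultilinear.

(** * Multilinearity and symmetry of iterated derivatives *)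

Section IteratedDerivatives.
Variables (R : realType) (d k : nat) (F : 'rV[R]_d -> 'rV[R]_d).
Hypothesis Fk : continuously_differentiable k F.
Implicit Types (a b e u v w h z : 'rV[R]_d) (l : seq 'rV[R]_d) (s t c : R).

Lemma iterdiff_differentiable l z : (size l < k)%N ->
  differentiable (iterdiff F l) z.
Proof. by move=> lk; exact: Fk.1. Qed.

Lemma iterdiff_continuous l : (size l <= k)%N -> continuous (iterdiff F l).
Proof.
rewrite leq_eqVlt => /orP[/eqP|lk z]; first exact: Fk.2.
exact/differentiable_continuous/iterdiff_differentiable.
Qed.

(** The head of the list is the outermost derivative. There the claim is linearity of the
    differential; deeper slots are reached by differentiating a linear combination, which asks for
    differentiability of its terms. *)
Lemma iterdiff_linear l1 l2 c u v : (size l1 + size l2 < k)%N ->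
  iterdiff F (l1 ++ (c *: u + v) :: l2) =
  c *: iterdiff F (l1 ++ u :: l2) + iterdiff F (l1 ++ v :: l2).
Proof.
elim: l1 => [|h l1 IH] lk; first by apply/funext => z; exact: linearP.
have /IH {}IH := ltnW lk.
apply/funext => z; rewrite [LHS]/= IH.
have dl w : differentiable (iterdiff F (l1 ++ w :: l2)) z.
  by apply: iterdiff_differentiable; rewrite size_cat /= addnS.
have e1 := congr1 (fun f => f h) (diffD (differentiableZ c (dl u)) (dl v)).
have e2 := congr1 (fun f => f h) (diffZ c (dl u)).
exact: (etrans e1 (congr1 (+%R^~ ('d (iterdiff F (l1 ++ v :: l2)) z h)) e2)).
Qed.

Lemma iterdiff0 l1 l2 : (size l1 + size l2 < k)%N ->
  iterdiff F (l1 ++ 0 :: l2) = 0.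
Proof.
move=> lk; have := iterdiff_linear (-1) 0 0 lk.
by rewrite scaler0 addr0 scaleN1r addNr.
Qed.

Lemma iterdiffZ l1 l2 c u : (size l1 + size l2 < k)%N ->
  iterdiff F (l1 ++ (c *: u) :: l2) = c *: iterdiff F (l1 ++ u :: l2).
Proof.
by move=> lk; have := iterdiff_linear c u 0 lk; rewrite addr0 iterdiff0// addr0.
Qed.

Lemma iterdiff_coord l1 l2 u : (size l1 + size l2 < k)%N ->
  iterdiff F (l1 ++ u :: l2) =
  \sum_(j < d) u 0 j *: iterdiff F (l1 ++ delta_mx 0 j :: l2).
Proof.
move=> lk; rewrite {1}(row_sum_coord u).
elim/big_rec2: _ => [|j v w _ IH]; first exact: iterdiff0.
by rewrite iterdiff_linear// IH.
Qed.

(** Only [l2] is bounded: once the two inner functions coincide, so do all further derivatives along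
    [l1]. *)
Lemma iterdiff_swap l1 l2 a b : (size l2 + 2 <= k)%N ->
  iterdiff F (l1 ++ a :: b :: l2) = iterdiff F (l1 ++ b :: a :: l2).
Proof.
move=> lk; elim: l1 => [|h l1 IH]; last by apply/funext => z /=; rewrite IH.
have l1k : (size l2 < k)%N by rewrite (leq_trans _ lk)// addn2.
apply/funext => z; apply: schwarz_symmetry => [x|x|x||].
- exact: iterdiff_differentiable.
- by apply: (@iterdiff_differentiable (b :: l2)); rewrite /= -addn2.
- by apply: (@iterdiff_differentiable (a :: l2)); rewrite /= -addn2.
- by apply: (@iterdiff_continuous [:: a, b & l2]); rewrite /= -addn2.
- by apply: (@iterdiff_continuous [:: b, a & l2]); rewrite /= -addn2.
Qed.

Lemma iterdiff_scale l1 l2 (c : 'rV[R]_d -> R) (g : 'rV[R]_d -> 'rV[R]_d) :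
  (size l1 + size l2 <= k)%N ->
  iterdiff F (l1 ++ [seq c h *: g h | h <- l2]) =
  (\prod_(h <- l2) c h) *: iterdiff F (l1 ++ map g l2).
Proof.
elim: l2 l1 => [|h l2 IH] l1 lk; first by rewrite big_nil scale1r.
rewrite /= iterdiffZ ?size_map -?addnS// -cat_rcons IH ?size_rcons ?addSnnS//.
by rewrite cat_rcons big_cons scalerA.
Qed.

End IteratedDerivatives.

(** * The regularized Taylor model: error, monotonicity, continuity *)

Section TaylorModel.
Variables (R : realType) (d m : nat) (F : 'rV[R]_d -> 'rV[R]_d) (L : R).
Hypothesis Fm : continuously_differentiable m.+1 F.
Hypothesis L_ge0 : 0 <= L.
Hypothesis F_lip : forall z z' : 'rV[R]_d,
  (opnorm (fun h : (m.+1).-tuple 'rV[R]_d => (iterdiff F h z - iterdiff F h z')%R)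
     <= (L * enorm (z - z'))%:E)%E.
Implicit Types (e h u w x y z : 'rV[R]_d) (l : seq 'rV[R]_d) (s t : R).

Lemma iterdiff_lipschitz l z z' : size l = m.+1 ->
  enorm (iterdiff F l z - iterdiff F l z') <=
  L * (\prod_(h <- l) enorm h) * enorm (z - z').
Proof.
(* Normalized directions; as [0^-1 = 0], the null vector goes to itself and still has norm at most
   1. *)
move=> sl; pose hat h := (enorm h)^-1 *: h.
have hatE h : enorm h *: hat h = h.
  have [h0|h0] := eqVneq (enorm h) 0; first by rewrite h0 scale0r (enorm_eq0 h0).
  by rewrite scalerA divff// scale1r.
have hat1 h : enorm (hat h) <= 1.
  rewrite enormZ ger0_norm ?invr_ge0 ?enorm_ge0//.
  have [->|h0] := eqVneq (enorm h) 0; first by rewrite mulr0.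
  by rewrite mulVf.
have lE : iterdiff F l = (\prod_(h <- l) enorm h) *: iterdiff F (map hat l).
  rewrite -[in LHS](map_id l) -(eq_map hatE).
  by apply: (iterdiff_scale Fm (l1 := [::])); rewrite sl.
rewrite lE [X in enorm X](_ : _ = (\prod_(h <- l) enorm h) *:
    (iterdiff F (map hat l) z - iterdiff F (map hat l) z')); last first.
  by rewrite scalerBr.
have P0 : 0 <= \prod_(h <- l) enorm h by apply: prodr_ge0 => h _; exact: enorm_ge0.
rewrite enormZ ger0_norm// mulrAC [leRHS]mulrC; apply: ler_wpM2l => //.
have sz : size (map hat l) == m.+1 by rewrite size_map sl.
rewrite -lee_fin; apply: le_trans (F_lip z z'); apply: ereal_sup_ubound.
exists (Tuple sz) => //= i; rewrite (tnth_nth 0) /=.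
have il : (i < size l)%N by rewrite sl.
by rewrite (nth_map 0)// hat1.
Qed.

(** Order [n] expansion of the derivative in the directions [l]: [l] empty serves the error of the
    model, a single direction serves the error of its slope. *)
Lemma taylor_remainder n l z w e : (n + size l)%N = m.+1 ->
  dot (iterdiff F l (z + w)) e -
    \sum_(i < n.+1) (i`!%:R)^-1 * dot (iterdiff F (nseq i w ++ l) z) e
  <= L * (\prod_(h <- l) enorm h) * enorm w ^+ n.+1 * enorm e / n.+1`!%:R.
Proof.
move=> nl; pose f i t := dot (iterdiff F (nseq i w ++ l) (z + t *: w)) e.
pose K := L * (\prod_(h <- l) enorm h) * enorm w ^+ n.+1 * enorm e.
have fd i t : (i < n)%N -> is_derive t 1 (f i) (f i.+1 t).
  move=> ilt; apply: is_derive_line; apply: (iterdiff_differentiable Fm).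
  by rewrite size_cat size_nseq -nl ltn_add2r.
have fK t : 0 <= t <= 1 -> f n t - f n 0 <= K * t.
  move=> /andP[t0 _]; rewrite /f -dotNl -dotDl; apply: le_trans (cauchy_schwarz _ _) _.
  rewrite /K mulrAC; apply: ler_wpM2r; first exact: enorm_ge0.
  apply: le_trans (iterdiff_lipschitz _ _ _) _; first by rewrite size_cat size_nseq.
  have -> : \prod_(h <- nseq n w ++ l) enorm h = enorm w ^+ n * \prod_(h <- l) enorm h.
    rewrite big_cat; congr (_ * _).
    by elim: (n) => [|i IH]; [rewrite big_nil|rewrite big_cons IH exprS].
  rewrite scale0r addr0 [z + _]addrC addrK enormZ ger0_norm// exprSr.
  by rewrite le_eqVlt; apply/orP; left; apply/eqP; ring.
have t1 : 0 <= (1 : R) <= 1 by rewrite ler01 lexx.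
have := taylor_upper fd fK t1.
rewrite expr1n mulr1 /f /= scale1r.
under eq_bigr do rewrite expr1n mulr1 scale0r addr0.
by [].
Qed.

Lemma dot_suml (I : Type) (r : seq I) (P : pred I) (f : I -> 'rV[R]_d) e :
  dot (\sum_(i <- r | P i) f i) e = \sum_(i <- r | P i) dot (f i) e.
Proof. by elim/big_rec2: _ => [|i a b _ <-]; rewrite ?dot0l ?dotDl. Qed.

Lemma dot_taylor x z e :
  dot (taylor m.+2 F L x z) e =
  \sum_(i < m.+2) (i`!%:R)^-1 * dot (iterdiff F (nseq i (x - z) ++ [::]) z) e +
  L / m.+1`!%:R * enorm (x - z) ^+ m.+1 * dot (x - z) e.
Proof.
rewrite /taylor /aep_lambda dotDl dotZl dotDl; congr (_ + _).
rewrite big_ord_recl invr1 mul1r; congr (_ + _).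
rewrite dot_suml big_add1 big_mkord; apply: eq_bigr => i _.
by rewrite dotZl cats0.
Qed.

(** The remainder contributes [L / p!] and the regularizer [L / (p - 1)! = p L / p!]; together
    [M / p!]. *)
Lemma taylor_error x z :
  enorm (F x - taylor m.+2 F L x z) <=
  aep_M m.+2 L / m.+2`!%:R * enorm (x - z) ^+ m.+2.
Proof.
have fact0 (i : nat) : 0 < i`!%:R :> R by rewrite ltr0n fact_gt0.
apply: enorm_le_of_dot.
  apply: mulr_ge0; last exact: (exprn_ge0 _ (enorm_ge0 _)).
  by apply: divr_ge0; [rewrite addr_ge0// mulr_ge0|exact: ltW].
set e := F x - _; have ee : e = F x - taylor m.+2 F L x z by [].
clearbody e.
rewrite {1}ee dotDl dotNl dot_taylor opprD addrA.
have := @taylor_remainder m.+1 [::] z (x - z) e (addn0 _).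
rewrite big_nil mulr1 [z + _]addrC subrK => h1.
have h2 : - (L / m.+1`!%:R * enorm (x - z) ^+ m.+1 * dot (x - z) e) <=
    L / m.+1`!%:R * enorm (x - z) ^+ m.+1 * (enorm (x - z) * enorm e).
  rewrite -mulrN; apply: ler_wpM2l.
    apply: mulr_ge0; last exact: (exprn_ge0 _ (enorm_ge0 _)).
    by apply: divr_ge0 => //; exact: ltW.
  by rewrite -dotNl -(enormN (x - z)); exact: cauchy_schwarz.
apply: le_trans (lerD h1 h2) _.
rewrite le_eqVlt; apply/orP; left; apply/eqP.
rewrite /aep_M /aep_lambda (exprS _ m.+1) factS natrM; field.
by rewrite -(natrD _ 2) !pnatr_eq0 -lt0n fact_gt0.
Qed.

(** The right side minus the left side is half of [(|u|^n - |w|^n) (|u|^2 - |w|^2)], whose factors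
    have the same sign. *)
Lemma regularizer_monotone n u w :
  (enorm w ^+ n + enorm u ^+ n) / 2 * dot (u - w) (u - w) <=
  enorm u ^+ n * dot u (u - w) - enorm w ^+ n * dot w (u - w).
Proof.
have h : 0 <= (enorm u ^+ n - enorm w ^+ n) * (enorm u ^+ 2 - enorm w ^+ 2).
  have [uw|/ltW wu] := leP (enorm u) (enorm w).
    by rewrite mulr_le0 ?subr_le0 ?lerXn2r ?nnegrE ?enorm_ge0.
  by rewrite mulr_ge0 ?subr_ge0 ?lerXn2r ?nnegrE ?enorm_ge0.
rewrite !enorm_sqr in h; rewrite !dotE (dotC w u).
move: (enorm u ^+ n) (enorm w ^+ n) h => a b; lra.
Qed.

(** The gap between [F] and its Taylor polynomial of degree [m + 1], followed along a segment, has
    as slope the order [m] remainder of the first derivative. *)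
Lemma model_gap_derivative w h z s :
  is_derive s 1 (fun t => dot (F (z + w + t *: h)) h -
      \sum_(i < m.+2) (i`!%:R)^-1 * dot (iterdiff F (nseq i (w + t *: h) ++ [::]) z) h)
    (dot (iterdiff F [:: h] (z + (w + s *: h))) h -
      \sum_(i < m.+1) (i`!%:R)^-1 * dot (iterdiff F (nseq i (w + s *: h) ++ [:: h]) z) h).
Proof.
have d1 : is_derive s 1 (fun t => dot (F (z + w + t *: h)) h)
    (dot (iterdiff F [:: h] (z + w + s *: h)) h).
  by apply: is_derive_line; exact: (iterdiff_differentiable Fm (l := [::])).
have d2 (i : 'I_m.+2) : is_derive s 1
    (fun t => (i`!%:R)^-1 * dot (iterdiff F (nseq i (w + t *: h) ++ [::]) z) h)
    ((i`!%:R)^-1 * (i%:R * dot (iterdiff F (nseq i.-1 (w + s *: h) ++ [:: h]) z) h)).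
  have := @is_derive_power R d m.+1 (fun l => iterdiff F l z) _ _ i [::] w h h s.
  move=> dp; apply: is_deriveZ; apply: dp => [l1 l2 c a b lk|l1 l2 a b lk|].
  - by rewrite (iterdiff_linear Fm).
  - by rewrite (iterdiff_swap Fm).
  - by rewrite addn0 -ltnS.
have -> : (fun t => dot (F (z + w + t *: h)) h -
      \sum_(i < m.+2) (i`!%:R)^-1 * dot (iterdiff F (nseq i (w + t *: h) ++ [::]) z) h)
  = (fun t => dot (F (z + w + t *: h)) h) - \sum_(i < m.+2)
      (fun t => (i`!%:R)^-1 * dot (iterdiff F (nseq i (w + t *: h) ++ [::]) z) h).
  by rewrite fct_sumE.
apply: (is_derive_eq (is_deriveB d1 (is_derive_sum d2))).
rewrite addrA; congr (_ - _).
rewrite big_ord_recl mul0r mulr0 add0r; apply: eq_bigr => i _.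
rewrite lift0 [i.+1.-1]/= factS natrM.
move: (dot _ h) => x; field.
by rewrite nat1r !pnatr_eq0 -lt0n fact_gt0.
Qed.

(** The choice [lambda = L] balances exactly: the Taylor gap costs at most [c |h|^2 (a + b) / 2],
    and the regularizer returns at least that. *)
Lemma taylor_monotone z : monotone_map F ->
  monotone_map (fun x => taylor m.+2 F L x z).
Proof.
move=> mF x y.
have mix (v1 v2 : 'rV[R]_d) t : v1 + t *: v2 = (1 - t) *: v1 + t *: (v1 + v2).
  by rewrite scalerDr addrA -scalerDl subrK scale1r.
set h := x - y; set w := y - z; set u := x - z.
have uE : u = w + h by rewrite /u /w /h [RHS]addrC addrA subrK.
pose phi t := dot (F (z + w + t *: h)) h -
  \sum_(i < m.+2) (i`!%:R)^-1 * dot (iterdiff F (nseq i (w + t *: h) ++ [::]) z) h.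
pose dphi t := dot (iterdiff F [:: h] (z + (w + t *: h))) h -
  \sum_(i < m.+1) (i`!%:R)^-1 * dot (iterdiff F (nseq i (w + t *: h) ++ [:: h]) z) h.
have c0 : 0 <= L / m.+1`!%:R by rewrite divr_ge0.
set c := L / m.+1`!%:R in c0.
set a := enorm w ^+ m.+1; set b := enorm u ^+ m.+1.
have dphi_le t : 0 <= t <= 1 -> dphi t <= c * dot h h * ((1 - t) * a + t * b).
  move=> t01; apply: le_trans (@taylor_remainder m [:: h] z (w + t *: h) h _) _.
    by rewrite addn1.
  rewrite big_seq1.
  have -> : L * enorm h * enorm (w + t *: h) ^+ m.+1 * enorm h / m.+1`!%:R =
     c * dot h h * enorm (w + t *: h) ^+ m.+1.
    by rewrite /c -enorm_sqr; ring.
  apply: ler_wpM2l; first by rewrite mulr_ge0// dot_ge0.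
  have /andP[t0 t1] := t01.
  apply: le_trans (convex_expn m.+1 t01 (enorm_ge0 w) (enorm_ge0 u)).
  apply: lerXn2r; rewrite ?nnegrE ?enorm_ge0//.
    by rewrite addr_ge0 ?mulr_ge0 ?subr_ge0 ?enorm_ge0.
  rewrite mix -uE.
  apply: le_trans (enormD _ _) _; rewrite !enormZ !ger0_norm//.
  by rewrite subr_ge0.
(* A primitive of the bound on [dphi]: the mean value theorem for [q - phi] replaces integration,
   and [q 1] is [c |h|^2 (a + b) / 2]. *)
pose q t := c * dot h h * (a * t + (b - a) / 2 * t ^+ 2).
have dq t : is_derive t 1 q (c * dot h h * ((1 - t) * a + t * b)).
  have d2 := DeriveDef (@exprn_derivable R 2 t 1) (@exp_derive R 2 t 1).
  have d1 := is_derive_id t (1 : R).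
  apply: (is_derive_eq (is_deriveZ (c * dot h h) (is_deriveD
     (is_deriveZ a d1) (is_deriveZ ((b - a) / 2) d2)))).
  by rewrite /GRing.scale /= expr1; field.
have [t /andP[t0 t1] e] := mean_value ltr01
  (fun t => is_deriveB (dq t) (model_gap_derivative w h z t)).
have gap : phi 1 - phi 0 <= c * dot h h * ((a + b) / 2).
  have t01 : 0 <= t <= 1 by rewrite !ltW.
  have := dphi_le _ t01; rewrite -subr_ge0 -[_ - dphi t]mulr1 -e.
  move=> gap; have : 0 <= (q 1 - phi 1) - (q 0 - phi 0) := gap.
  rewrite /q; move: (phi 1) (phi 0) (c * _) => p1 p0 C; lra.
have F_xy := mF x y.
have phi1 : phi 1 = dot (F x) h - \sum_(i < m.+2)
    (i`!%:R)^-1 * dot (iterdiff F (nseq i u ++ [::]) z) h.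
  by rewrite /phi scale1r -uE -addrA -uE [z + u]addrC subrK.
have phi0 : phi 0 = dot (F y) h - \sum_(i < m.+2)
    (i`!%:R)^-1 * dot (iterdiff F (nseq i w ++ [::]) z) h.
  by rewrite /phi scale0r !addr0 [z + w]addrC subrK.
have reg := regularizer_monotone m.+1 u w.
rewrite (_ : u - w = h) in reg; last by rewrite uE addrC addKr.
rewrite dotDl dotNl !dot_taylor -/u -/w -/h -/c -/a -/b.
rewrite dotDl dotNl -/h in F_xy.
have := ler_wpM2l c0 reg; rewrite -/a -/b.
move: gap; rewrite phi1 phi0.
move: (dot (F x) h) (dot (F y) h) (\sum_(i < _) _) (\sum_(i < _) _) F_xy => *.
lra.
Qed.

(** Continuity is known for fixed directions; expanding one slot at a time in coordinates makes it
    joint in direction and base point. *)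
Lemma cvg_iterdiff_power (T : Type) (G : set_system T) (FG : Filter G)
    (f g : T -> 'rV[R]_d) w z i l : (i + size l <= m.+1)%N ->
  f @ G --> w -> g @ G --> z ->
  (fun t : T => iterdiff F (nseq i (f t) ++ l) (g t)) @ G -->
  iterdiff F (nseq i w ++ l) z.
Proof.
move=> + fw gz; elim: i l => [|i IH] l lk.
  exact: (cvg_comp g (iterdiff F l) gz (iterdiff_continuous Fm lk (x:=z))).
have ik : (i + size l < m.+1)%N by rewrite addSn in lk.
have E v x : iterdiff F (nseq i.+1 v ++ l) x =
    \sum_(j < d) v 0 j *: iterdiff F (nseq i v ++ delta_mx 0 j :: l) x.
  by rewrite nseq_catS (iterdiff_coord Fm) ?size_nseq// fct_sumE.
rewrite E; under eq_fun => t0 do rewrite E.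
apply: cvg_big => [|j _]; first exact: add_continuous.
apply: cvgZ.
  exact: (cvg_comp f (fun v : 'rV[R]_d => v 0 j) fw (@coord_continuous _ _ _ _ _ _)).
by apply: IH; rewrite /= addnS.
Qed.

Lemma cvg_taylor (T : Type) (G : set_system T) (FG : Filter G)
    (f g : T -> 'rV[R]_d) x z :
  f @ G --> x -> g @ G --> z ->
  (fun t : T => taylor m.+2 F L (f t) (g t)) @ G --> taylor m.+2 F L x z.
Proof.
move=> fx gz; have fg : (fun t : T => f t - g t) @ G --> x - z by exact: cvgB.
rewrite /taylor; apply: cvgD; first apply: cvgD.
- exact: (cvg_comp g F gz (iterdiff_continuous Fm (l := [::]) isT (x:=z))).
- rewrite [in X in _ --> X]big_add1 big_mkord.
  under eq_fun do rewrite big_add1 big_mkord.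
  apply: cvg_big => [|i _]; first exact: add_continuous.
  apply: cvgZl_tmp; rewrite -[nseq _ _]cats0.
  under eq_fun do rewrite -[nseq _ _]cats0.
  by apply: cvg_iterdiff_power => //; rewrite addn0.
- apply: cvgZ => //; apply: cvgMl_tmp.
  exact: cvg_enormX.
Qed.

End TaylorModel.

(** * Termination of the bisection *)

Section Bisection.
Variables (R : realType) (f : R -> R) (c1 c2 K : R).
Hypotheses (c1_gt0 : 0 < c1) (c12 : c1 < c2).
Hypothesis f0 : f 0 < c1.
Hypothesis f_cont : forall a : R, 0 < a -> f @ a --> f a.
Hypothesis f_small : forall a : R, 0 < a <= 1 -> f a <= K * a.

Let bracket (q : R * R) := [/\ 0 <= q.1, q.1 < q.2, f q.1 < c1 & c2 < f q.2].

(** As [c1 < c2], a value of [f] at [l] is below [c2] or above [c1], and continuity preserves this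
    nearby. At 0 the linear bound [f_small] takes the place of continuity. *)
Lemma locally_one_sided (l : R) : 0 <= l -> exists2 e : R, 0 < e &
  (forall x, 0 <= x -> `|x - l| < e -> f x < c2) \/
  (forall x, 0 <= x -> `|x - l| < e -> c1 < f x).
Proof.
rewrite le_eqVlt => /predU1P[<-|l0].
  have K0 : 0 < `|K| + 1 by rewrite ltr_wpDl.
  exists (Num.min 1 (c2 / (`|K| + 1))).
    by rewrite lt_min ltr01 divr_gt0// (lt_trans c1_gt0).
  left=> x x0; rewrite subr0 ger0_norm// lt_min => /andP[x1 xc].
  have [->|xn0] := eqVneq x 0; first exact: lt_trans c12.
  have xp : 0 < x by rewrite lt_def xn0.
  apply: le_lt_trans (_ : K * x < _); first by rewrite f_small// xp ltW.
  rewrite ltr_pdivlMr// in xc; apply: le_lt_trans xc.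
  by rewrite mulrC ler_wpM2l// ler_wpDr// ler_norm.
have [fl|fl] := ltP (f l) c2.
  have /cvgrPdist_lt/(_ (c2 - f l)) := f_cont l0.
  rewrite subr_gt0 => /(_ fl)/nbhs_ballP[e /= e0 he].
  exists e => //; left=> x _ xl; have := he x.
  rewrite /ball/= distrC => /(_ xl); rewrite ltr_norml => /andP[]; lra.
have /cvgrPdist_lt/(_ (f l - c1)) := f_cont l0.
rewrite subr_gt0 => /(_ (lt_le_trans c12 fl))/nbhs_ballP[e /= e0 he].
exists e => //; right=> x _ xl; have := he x.
rewrite /ball/= distrC => /(_ xl); rewrite ltr_norml => /andP[]; lra.
Qed.

(** [bad] stands for a bracket on which the loop never ends. Nested bad brackets shrink to a point
    [l], near which [f] cannot take values both below [c1] and above [c2]. *)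
Lemma bracket_midpoint (bad : R * R -> Prop) :
  (forall lo hi, bad (lo, hi) -> let mid := (lo + hi) / 2 in
     (f mid < c1 /\ bad (mid, hi)) \/ (c2 < f mid /\ bad (lo, mid))) ->
  forall q, bracket q -> ~ bad q.
Proof.
move=> halve [lo0 hi0] bq0 bad0.
pose next (q : R * R) := if f ((q.1 + q.2) / 2) < c1
  then ((q.1 + q.2) / 2, q.2) else (q.1, (q.1 + q.2) / 2).
pose q n := iter n next (lo0, hi0).
have qP n : [/\ bracket (q n), bad (q n) &
    (q n).2 - (q n).1 = (hi0 - lo0) / 2 ^+ n].
  elim: n => [|n [[l0 lh fl fh] bn wn]]; first by rewrite divr1.
  have qS : q n.+1 = next (q n) by [].
  have mid_in : (q n).1 < ((q n).1 + (q n).2) / 2 < (q n).2 by lra.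
  have [ml mh] := andP mid_in.
  have wS : (hi0 - lo0) / 2 ^+ n.+1 = ((q n).2 - (q n).1) / 2.
    by rewrite wn exprSr invfM mulrA.
  have bn' : bad ((q n).1, (q n).2) by case: (q n) bn.
  rewrite qS /next wS; case: (halve _ _ bn') => [[fm bm]|[fm bm]].
    by rewrite fm /=; split=> //; [split=> //=; lra|lra].
  have -> : (f (((q n).1 + (q n).2) / 2) < c1) = false.
    by apply/negbTE; rewrite -leNgt ltW// (lt_trans c12).
  by split=> //=; lra.
have mono n k : (q n).1 <= (q (n + k)%N).1 /\ (q (n + k)%N).2 <= (q n).2.
  elim: k => [|k [IH1 IH2]]; first by rewrite addn0.
  rewrite addnS; have [[l0 lh _ _] _ _] := qP (n + k)%N.
  have -> : q (n + k).+1 = next (q (n + k)%N) by [].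
  by rewrite /next; case: ifP => _ /=; split=> //; lra.
have lo_hi n k : (q n).1 <= (q k).2.
  have [m1 _] := mono n k; have [_] := mono k n; rewrite addnC => m2.
  have [[_ lh _ _] _ _] := qP (n + k)%N; lra.
pose S := [set (q n).1 | n in [set: nat]].
have S0 : S !=set0 by exists (q 0%N).1; exists 0%N.
have Sub : has_ubound S by exists (q 0%N).2 => _ [n _ <-]; exact: lo_hi.
pose l := sup S.
have lo_l n : (q n).1 <= l by apply: ub_le_sup => //; exists n.
have l_hi n : l <= (q n).2 by apply: ge_sup => // _ [k _ <-]; exact: lo_hi.
have l0 : 0 <= l by have [[l0 _ _ _] _ _] := qP 0%N; apply: le_trans (lo_l 0%N).
have [e e0 he] := locally_one_sided l0.
have [n wn] : exists n, (hi0 - lo0) / 2 ^+ n < e.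
  have [_ lh0 _ _] := bq0.
  have w0 : 0 <= (hi0 - lo0) / e by rewrite divr_ge0// ltW// subr_gt0.
  exists (Num.bound ((hi0 - lo0) / e)).
  rewrite ltr_pdivrMr ?exprn_gt0// mulrC -ltr_pdivrMr//.
  apply: lt_trans (archi_boundP w0) _.
  by rewrite -natrX ltr_nat ltn_expl.
have [[q0 lh fl fh] _ wE] := qP n.
have := lo_l n; have := l_hi n => h1 h2.
case: he => he.
  have : f (q n).2 < c2.
    by apply: he; [lra|rewrite ger0_norm ?subr_ge0//; lra].
  by lra.
have : c1 < f (q n).1.
  by apply: he => //; rewrite ler0_norm ?subr_le0//; lra.
by lra.
Qed.

End Bisection.

(** * One iteration: solvability, continuity in the step size, decrease of the potential *)

Section Step.
Variables (R : realType) (d m : nat) (F : 'rV[R]_d -> 'rV[R]_d).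
Variables (H : 'rV[R]_d -> set 'rV[R]_d) (L : R) (z0 : 'rV[R]_d).
Hypothesis mF : monotone_map F.
Hypothesis Fm : continuously_differentiable m.+1 F.
Hypothesis L_gt0 : 0 < L.
Hypothesis F_lip : forall z z' : 'rV[R]_d,
  (opnorm (fun h : (m.+1).-tuple 'rV[R]_d => (iterdiff F h z - iterdiff F h z')%R)
     <= (L * enorm (z - z'))%:E)%E.
Hypothesis mH : maximal_monotone H.
Hypothesis H0 : exists u, op_dom H u.

Local Notation p := m.+2.
Local Notation rho := (aep_rho R).
Local Notation M := (aep_M p L).

Let L_ge0 : 0 <= L := ltW L_gt0.

Lemma aep_M_gt0 : 0 < M.
Proof. by rewrite /aep_M /aep_lambda ltr_pwDl// mulr_ge0. Qed.

Lemma aep_rho_gt0 : 0 < rho.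
Proof. by rewrite invr_gt0 sqrtr_gt0. Qed.

Lemma aep_rho_sqr : rho ^+ 2 = 2^-1.
Proof. by rewrite exprVn sqr_sqrtr. Qed.

Lemma fact_gt0R (n : nat) : 0 < n`!%:R :> R.
Proof. by rewrite ltr0n fact_gt0. Qed.

Section State.
Variable st : aep_state R d.
Implicit Types (a : R) (z h : 'rV[R]_d).
Local Notation zk := (aep_z st).
Local Notation vk := (aep_v st).
Local Notation A := (aep_A st).
Local Notation anchor := (aep_anchor z0 st).
Local Notation half := (aep_half F z0 st).
Local Notation next := (aep_next p F H L z0 st).
Local Notation vnext := (aep_vnext p F H L z0 st).
Local Notation psi := (aep_psi p F H L z0 st).
Local Notation T a := (fun z => taylor p F L z (half a)).
Hypothesis Hk : H zk vk.
Hypothesis A_ge0 : 0 <= A.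

Lemma aep_next_spec a : 0 < a ->
  H (next a) (vnext a) /\
  a *: (T a (next a) + vnext a) = anchor a - next a.
Proof.
move=> a0; have an0 : a != 0 by rewrite gt_eqF.
have [|h] := @getPex _ (aep_subproblem p F H L z0 st a).
  have cT : continuous (T a).
    apply: continuous_along => x S G g FG gx.
    by apply: (cvg_taylor Fm) => //; exact: cvg_cst.
  have [z Hz] := monotone_sum_solvable (anchor a) mH H0
    (taylor_monotone Fm L_ge0 F_lip (half a) mF) cT a0.
  exists z, (a^-1 *: (anchor a - z) - T a z) => //.
  rewrite scalerBr scalerA divff// scale1r /aep_P [T a z]/=.
  move: (anchor a) (a *: T a z) => y t.
  by apply/rowP => i; rewrite !mxE; ring.
rewrite -/(next a) => Hh e.
have -> : vnext a = h.
  rewrite /vnext; apply: (scalerI an0).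
  rewrite scalerBr scalerA divff// scale1r; apply/eqP.
  rewrite -subr_eq0; apply/eqP; rewrite -[RHS]oppr0 e; apply/rowP => i.
  by rewrite !mxE; ring.
split=> //; apply/eqP; rewrite -subr_eq0 scalerDr; apply/eqP; rewrite [RHS]e.
by rewrite /aep_P opprB addrA.
Qed.

(** Strong monotonicity of the subproblem: the residual of any pair in the graph of [H] controls its
    distance to the solution. *)
Lemma aep_next_dist a z h : 0 < a -> H z h ->
  enorm (next a - z) <= enorm (anchor a - z - a *: (T a z + h)).
Proof.
move=> a0 Hz; have [Hn e] := aep_next_spec a0.
apply: enorm_le_of_dot; first exact: enorm_ge0.
apply: le_trans (cauchy_schwarz _ _).
have := mH.1 _ _ _ _ Hn Hz.
have := taylor_monotone Fm L_ge0 F_lip (half a) mF (next a) z.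
rewrite /=.
set t1 := taylor _ _ _ (next a) _ in e *; set t2 := taylor _ _ _ z _.
move: (next a) (vnext a) (anchor a) e => x v y e h1 h2.
have -> : y - z - a *: (t2 + h) = (x - z) + a *: ((t1 - t2) + (v - h)).
  have -> : y = x + a *: (t1 + v) by rewrite e addrC subrK.
  by clearbody t1 t2; apply/rowP => i; rewrite !mxE; ring.
rewrite [leRHS]dotDl lerDl dotZl; apply: (mulr_ge0 (ltW a0)).
by rewrite [X in 0 <= X]dotDl addr_ge0.
Qed.

Lemma cvg_ratios a0 : 0 < a0 ->
  (fun a => a / (A + a)) @ a0 --> a0 / (A + a0) /\
  (fun a => A / (A + a)) @ a0 --> A / (A + a0).
Proof.
move=> a00; have Aa0 : A + a0 != 0 by rewrite gt_eqF// ltr_wpDl.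
have c : (fun a => (A + a)^-1) @ a0 --> (A + a0)^-1.
  by apply: cvgV => //; apply: cvgD; [exact: cvg_cst|exact: cvg_id].
by split; apply: cvgM => //; exact: cvg_cst.
Qed.

Lemma cvg_anchor a0 : 0 < a0 -> anchor @ a0 --> anchor a0.
Proof.
move=> /cvg_ratios[c1 c2]; rewrite /aep_anchor.
by apply: cvgD; apply: cvgZr_tmp.
Qed.

Lemma cvg_half a0 : 0 < a0 -> half @ a0 --> half a0.
Proof.
move=> /cvg_ratios[c1 c2]; rewrite /aep_half.
apply: cvgD; first exact: cvgZr_tmp.
apply: cvgZ => //; apply: cvgB; first exact: cvg_cst.
by apply: cvgZr_tmp; exact: cvg_id.
Qed.

Lemma cvg_next a0 : 0 < a0 -> next @ a0 --> next a0.
Proof.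
move=> a00; have [Hn e] := aep_next_spec a00.
(* The residual, at step size [a], of the solution for [a0]: explicit in [a], and zero at [a0]. *)
pose bnd a := enorm (anchor a - next a0 - a *: (T a (next a0) + vnext a0)).
have bnd0 : bnd @ a0 --> (0 : R).
  have -> : (0 : R) = enorm (anchor a0 - next a0 - a0 *: (T a0 (next a0) + vnext a0)).
    by rewrite e subrr enorm0.
  apply: cvg_enorm; apply: cvgB.
    by apply: cvgB; [exact: cvg_anchor|exact: cvg_cst].
  apply: cvgZ; first exact: cvg_id.
  apply: cvgD; last exact: cvg_cst.
  by apply: (cvg_taylor Fm); [exact: cvg_cst|exact: cvg_half].
apply: cvg_of_enorm.
apply: (@squeeze_cvgr _ _ _ _ (cst 0) bnd) => //; last exact: cvg_cst.
near=> a; rewrite enorm_ge0/= aep_next_dist//.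
by near: a; exact: lt_nbhsr.
Unshelve. all: by end_near. Qed.

Lemma cvg_psi a0 : 0 < a0 -> psi @ a0 --> psi a0.
Proof.
move=> a00; rewrite /aep_psi; apply: cvgM.
  by apply: cvgM; [exact: cvg_cst|exact: cvg_id].
apply: cvg_enormX; apply: cvgB; [exact: cvg_next|exact: cvg_half].
Qed.

Lemma aep_ratios a : 0 < a -> 0 <= a / (A + a) <= 1 /\ 0 <= A / (A + a) <= 1.
Proof.
move=> a0; have Aa0 : 0 < A + a by rewrite ltr_wpDl.
by rewrite !divr_ge0 ?(ltW a0) ?(ltW Aa0)//= !ler_pdivrMr// !mul1r lerDr lerDl (ltW a0).
Qed.

(** Comparison with the pair [(zk, vk)] keeps the displacement bounded for [a <= 1]; the factor [a]
    of the merit function does the rest. *)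
Lemma aep_psi_small : exists K, forall a, 0 < a <= 1 -> psi a <= K * a.
Proof.
pose g := F zk + vk; pose r0 := enorm (z0 - zk) + enorm g.
pose C := aep_M p L / p`!%:R * r0 ^+ p.
have C0 : 0 <= C.
  apply: mulr_ge0; first by rewrite divr_ge0// ltW// aep_M_gt0.
  by rewrite exprn_ge0// addr_ge0 ?enorm_ge0.
have r00 : 0 <= r0 by rewrite addr_ge0 ?enorm_ge0.
exists (M * (r0 + (C + enorm g) + r0) ^+ m.+1) => a /andP[a0 a1].
have [/andP[t0 t1] /andP[s0 s1]] := aep_ratios a0.
have ts : A / (A + a) = 1 - a / (A + a).
  by field; rewrite gt_eqF// ltr_wpDl.
have zk_half : enorm (zk - half a) <= r0.
  have -> : zk - half a = - ((a / (A + a)) *: (z0 - zk)) + (A / (A + a) * a) *: g.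
    by rewrite /aep_half -/g ts; clearbody g; apply/rowP => i; rewrite !mxE; ring.
  have sa : 0 <= A / (A + a) * a := mulr_ge0 s0 (ltW a0).
  apply: le_trans (enormD _ _) _; rewrite enormN !enormZ !ger0_norm//.
  apply: lerD; first by rewrite ler_piMl ?enorm_ge0.
  by rewrite ler_piMl ?enorm_ge0// mulr_ile1// ltW.
have Tzk : enorm (T a zk + vk) <= C + enorm g.
  have -> : T a zk + vk = - (F zk - T a zk) + g.
    by rewrite /g opprB addrA addrNK.
  apply: le_trans (enormD _ _) _; rewrite enormN lerD2r.
  apply: le_trans (taylor_error Fm L_ge0 F_lip zk (half a)) _.
  apply: ler_wpM2l; first by rewrite divr_ge0// ltW// aep_M_gt0.
  by rewrite lerXn2r// nnegrE enorm_ge0.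
have next_zk : enorm (next a - zk) <= r0 + (C + enorm g).
  apply: le_trans (aep_next_dist a0 Hk) _.
  have -> : anchor a - zk = (a / (A + a)) *: (z0 - zk).
    by rewrite /aep_anchor ts; apply/rowP => i; rewrite !mxE; ring.
  apply: le_trans (enormB _ _) _; rewrite !enormZ !ger0_norm ?(ltW a0)//.
  apply: lerD.
    by rewrite ler_wpDr ?enorm_ge0// ler_piMl ?enorm_ge0.
  by apply: le_trans Tzk; rewrite ler_piMl ?enorm_ge0.
rewrite /aep_psi mulrAC; apply: (ler_wpM2r (ltW a0)).
apply: (ler_wpM2l (ltW aep_M_gt0)); apply: lerXn2r.
- by rewrite nnegrE enorm_ge0.
- by rewrite nnegrE !addr_ge0 ?enorm_ge0.
rewrite -[next a](subrK zk) -addrA.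
by apply: le_trans (enormD _ _) _; exact: lerD.
Qed.

Lemma thresholds : 0 < p`!%:R * rho / Num.sqrt 2 /\
  p`!%:R * rho / Num.sqrt 2 < p`!%:R * rho :> R.
Proof.
have c2 : 0 < p`!%:R * rho by rewrite mulr_gt0 ?fact_gt0R ?aep_rho_gt0.
have s2 : 1 < Num.sqrt 2 :> R by rewrite -[X in X < _]sqrtr1 ltr_sqrt ?ltr1n ?ltr0n.
have s0 : 0 < Num.sqrt 2 :> R by rewrite (lt_trans ltr01).
by rewrite divr_gt0// ltr_pdivrMr// ltr_pMr.
Qed.

Lemma aep_bisect_terminates b : 0 < b -> p`!%:R * rho < psi b ->
  exists a, aep_bisect p F H L z0 st 0 b a.
Proof.
move=> b0 pb; apply: contrapT => none.
have [c1_gt0 c12] := thresholds; have [K psiK] := aep_psi_small.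
have psi0 : psi 0 = 0 by rewrite /aep_psi mulr0 mul0r.
pose bad (q : R * R) := ~ exists a, aep_bisect p F H L z0 st q.1 q.2 a.
have f0 : psi 0 < p`!%:R * rho / Num.sqrt 2 by rewrite psi0.
apply: (bracket_midpoint c1_gt0 c12 f0 cvg_psi psiK (bad := bad) _ _ (q := (0, b))) => //.
move=> lo hi bd mid.
have [lt1|le1] := ltP (psi mid) (p`!%:R * rho / Num.sqrt 2).
  by left; split=> // -[a ha]; apply: bd; exists a; exact: Bisect_up lt1 ha.
have [lt2|le2] := ltP (p`!%:R * rho) (psi mid).
  by right; split=> // -[a ha]; apply: bd; exists a; exact: Bisect_down lt2 ha.
by exfalso; apply: bd; exists mid; exact: Bisect_accept.
Qed.

Lemma aep_bisectP lo hi a : aep_bisect p F H L z0 st lo hi a ->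
  0 <= lo -> 0 < hi ->
  [/\ 0 < a, p`!%:R * rho / Num.sqrt 2 <= psi a & psi a <= p`!%:R * rho].
Proof.
elim=> {lo hi a} [lo hi a _ _ IH l0 h0|lo hi a _ _ IH l0 h0|lo hi h1 h2 l0 h0].
- by apply: IH => //; lra.
- by apply: IH => //; lra.
- by split=> //; lra.
Qed.

(** The bound of [taylor_error] times [a] is [psi a / p!] times the displacement, so the upper
    threshold is a relative error criterion with ratio [rho]. *)
Lemma aep_step_error a : 0 < a -> psi a <= p`!%:R * rho ->
  a * enorm (T a (next a) - F (next a)) <= rho * enorm (next a - half a).
Proof.
move=> a0 hpsi; set r := enorm (next a - half a).
have r0 : 0 <= r := enorm_ge0 _.
rewrite enormBC.
apply: le_trans (ler_wpM2l (ltW a0) (taylor_error Fm L_ge0 F_lip _ _)) _.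
rewrite -/r exprSr.
have -> : a * (aep_M p L / p`!%:R * (r ^+ m.+1 * r)) = psi a / p`!%:R * r.
  by rewrite /aep_psi -/r; ring.
apply: (ler_wpM2r r0); rewrite ler_pdivrMr ?fact_gt0R//.
by rewrite mulrC.
Qed.

(** Here [e] is the model error. The first identity is the implicit step seen from [z0]; the second
    holds because the anchor minus the extrapolated point is [A a / (A + a)] times the old residual
    vector. *)
Lemma aep_step_eq a (g' e : 'rV[R]_d) : 0 < a ->
  g' = F (next a) + vnext a -> e = T a (next a) - F (next a) ->
  [/\ (A + a) *: (next a - z0) + ((A + a) * a) *: (g' + e) = A *: (zk - z0) &
      (A + a) *: (next a - half a) =
        - (a *: ((A + a) *: (g' + e) - A *: (F zk + vk)))].
Proof.
move=> a0 gE eE; have [_ en] := aep_next_spec a0.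
have ge : g' + e = T a (next a) + vnext a.
  by rewrite gE eE addrC addrA subrK.
have Aa0 : A + a != 0 by rewrite gt_eqF// ltr_wpDl.
have nE : next a = anchor a - a *: (g' + e) by rewrite ge en opprB addrC subrK.
move: (g' + e) nE => s nE; split; rewrite nE /aep_anchor /aep_half.
  by apply/rowP => i; rewrite !mxE; field.
by move: (F zk + vk) => g; apply/rowP => i; rewrite !mxE; field.
Qed.

Definition potential (s : aep_state R d) : R :=
  let g := F (aep_z s) + aep_v s in
  aep_A s ^+ 2 / 2 * dot g g + aep_A s * dot g (aep_z s - z0).

(** Testing the equation against [(b + a) g'] and [b g] shows that [a] times the right side minus
    the left side equals [b (b + a) <g' - g, q - w>]. *)
Lemma potential_algebra (b a : R) (g g' e q w : 'rV[R]_d) : 0 <= b -> 0 < a ->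
  (b + a) *: q + ((b + a) * a) *: (g' + e) = b *: w ->
  0 <= dot (g' - g) (q - w) ->
  (b + a) ^+ 2 / 2 * dot g' g' + (b + a) * dot g' q <=
  b ^+ 2 / 2 * dot g g + b * dot g w
  - dot ((b + a) *: (g' + e) - b *: g) ((b + a) *: (g' + e) - b *: g) / 2
  + (b + a) ^+ 2 / 2 * dot e e.
Proof.
move=> b0 a0 eq mon.
have e1 := congr1 (fun v => (b + a) * dot g' v) eq.
have e2 := congr1 (fun v => b * dot g v) eq.
have ba0 : 0 <= b * (b + a) by rewrite mulr_ge0// addr_ge0// ltW.
have {}mon := mulr_ge0 ba0 mon.
rewrite -(ler_pM2l a0) -subr_ge0; move: mon e1 e2.
rewrite !dotE (dotC g g') (dotC g e) (dotC e g') => mon e1 e2.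
lra.
Qed.

(** The step gains [|X|^2 / 2], with [|X|] the movement term, and the model error takes back at most
    [rho^2 |X|^2 / 2 = |X|^2 / 4]. *)
Lemma potential_decrease a : 0 < a -> psi a <= p`!%:R * rho ->
  potential (aep_update p F H L z0 st a) <=
  potential st - ((A + a) * enorm (next a - half a) / a) ^+ 2 / 4.
Proof.
move=> a0 hpsi; have [Hn en] := aep_next_spec a0.
pose g' := F (next a) + vnext a; pose e := T a (next a) - F (next a).
have [eq1 eq2] := aep_step_eq a0 (erefl g') (erefl e).
have err : a * enorm e <= rho * enorm (next a - half a) := aep_step_error a0 hpsi.
pose X := (A + a) *: (g' + e) - A *: (F zk + vk).
have Aa0 : 0 < A + a by rewrite ltr_wpDl.
have rX : (A + a) * enorm (next a - half a) = a * enorm X.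
  have := congr1 (@enorm R d) eq2.
  by rewrite enormN !enormZ !gtr0_norm.
have -> : (A + a) * enorm (next a - half a) / a = enorm X.
  by rewrite rX mulrC mulKf// gt_eqF.
have eX : (A + a) ^+ 2 * dot e e <= dot X X / 2.
  have h : (A + a) * enorm e <= rho * enorm X.
    rewrite -(ler_pM2l a0) [leRHS]mulrCA -rX mulrCA [leRHS]mulrCA.
    by apply: ler_wpM2l => //; exact: ltW.
  have h0 : 0 <= (A + a) * enorm e by rewrite mulr_ge0 ?enorm_ge0// ltW.
  have h1 : 0 <= rho * enorm X := le_trans h0 h.
  rewrite -!enorm_sqr -exprMn mulrC -aep_rho_sqr -exprMn.
  by rewrite [enorm e * _]mulrC [enorm X * _]mulrC lerXn2r ?nnegrE.
have mon : 0 <= dot (g' - (F zk + vk)) (next a - z0 - (zk - z0)).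
  have -> : g' - (F zk + vk) = (F (next a) - F zk) + (vnext a - vk).
    by rewrite /g' opprD addrACA.
  have -> : next a - z0 - (zk - z0) = next a - zk by rewrite opprB addrA subrK.
  rewrite dotDl; apply: addr_ge0; first exact: mF.
  exact: (mH.1 _ _ _ _ Hn Hk).
have := potential_algebra A_ge0 a0 eq1 mon.
rewrite /potential /= -/g' -/X enorm_sqr => h.
apply: le_trans h _; rewrite mulrAC; lra.
Qed.

Lemma aep_abar_gt0 eps : 0 < eps -> 0 < aep_abar p F L eps st.
Proof.
move=> eps0; rewrite lt_max; apply/orP; right; apply: powR_gt0.
rewrite mulr_gt0// ?divr_gt0 ?mulr_gt0 ?addr_gt0 ?aep_rho_gt0//.
by apply: powR_gt0; rewrite divr_gt0 ?aep_M_gt0// mulr_gt0 ?fact_gt0R ?aep_rho_gt0.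
Qed.

(** Each term of the maximum pays for half of [eps]: the first covers the old residual,
    [A G <= eps a / 2], the second covers displacement and model error,
    [(1 + rho) r <= eps a / 2]. *)
Lemma aep_upper_residual eps (a := aep_abar p F L eps st) : 0 < eps ->
  psi a <= p`!%:R * rho -> enorm (F (next a) + vnext a) <= eps.
Proof.
move=> eps0 hpsi; have a0 : 0 < a := aep_abar_gt0 eps0.
pose g' := F (next a) + vnext a; pose e := T a (next a) - F (next a).
have [_ eq2] := aep_step_eq a0 (erefl g') (erefl e).
have err : a * enorm e <= rho * enorm (next a - half a) := aep_step_error a0 hpsi.
have Aa0 : 0 < A + a by rewrite ltr_wpDl.
set r := enorm (next a - half a) in err *; set G := enorm (F zk + vk).
have r0 : 0 <= r := enorm_ge0 _.
have G0 : 0 <= G := enorm_ge0 _.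
have h1 : a * ((A + a) * enorm g') <= (A + a) * r + a * (A + a) * enorm e + a * A * G.
  have -> : a * ((A + a) * enorm g') = enorm ((a * (A + a)) *: g').
    by rewrite enormZ gtr0_norm ?mulr_gt0// mulrA.
  have -> : (a * (A + a)) *: g' =
      - ((A + a) *: (next a - half a)) - (a * (A + a)) *: e + (a * A) *: (F zk + vk).
    rewrite eq2 opprK; clear eq2 err; move: (F zk + vk) g' e => g g' e.
    by apply/rowP => i; rewrite !mxE; ring.
  apply: le_trans (enormD _ _) _; rewrite enormZ ger0_norm ?mulr_ge0 ?(ltW a0)// lerD2r.
  apply: le_trans (enormB _ _) _; rewrite enormN !enormZ !gtr0_norm ?mulr_gt0//.
have aG : 2 * A * G <= eps * a.
  rewrite [leRHS]mulrC -ler_pdivrMr//; rewrite /a /aep_abar le_max; apply/orP; left.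
  by rewrite -/G.
pose B := 2 * (1 + rho) / eps * (p`!%:R * rho / M) `^ (p.-1%:R)^-1.
have rho0 := aep_rho_gt0; have M0 := aep_M_gt0; have pf := fact_gt0R p.
have q0 : 0 < p`!%:R * rho / M by rewrite divr_gt0// mulr_gt0.
have B0 : 0 < B by rewrite mulr_gt0 ?powR_gt0// divr_gt0// mulr_gt0// addr_gt0.
have aB : B ^+ m.+1 <= a ^+ m.+2.
  have : B `^ (p.-1%:R / p%:R) <= a by rewrite /a /aep_abar le_max lexx orbT.
  move=> /(lerXn2r m.+2); rewrite !nnegrE powR_ge0 (ltW a0) => /(_ isT isT).
  by rewrite -[X in X <= _]powR_mulrn ?powR_ge0// -powRrM divfK ?pnatr_eq0//
    powR_mulrn// ltW.
(* Raised to the power [p - 1] and multiplied by [a], this follows from [aB] and the upper threshold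
   on [psi]. *)
have rB : (1 + rho) * r <= eps * a / 2.
  have rho1 : 0 < 1 + rho by rewrite addr_gt0.
  have h0 : 0 <= eps * a / 2 by rewrite divr_ge0// mulr_ge0// ltW.
  rewrite -(ler_pXn2r (n := m.+1)) ?nnegrE//; last by rewrite mulr_ge0// ltW.
  rewrite -(ler_pM2l a0).
  have -> : a * (eps * a / 2) ^+ m.+1 = (eps / 2) ^+ m.+1 * a ^+ m.+2.
    by rewrite mulrAC exprMn mulrCA -exprS.
  apply: le_trans (ler_wpM2l _ aB); last by rewrite exprn_ge0// divr_ge0// ltW.
  rewrite -exprMn /B.
  have -> : eps / 2 * (2 * (1 + rho) / eps * (p`!%:R * rho / M) `^ (p.-1%:R)^-1) =
      (1 + rho) * (p`!%:R * rho / M) `^ (p.-1%:R)^-1.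
    by move: (_ `^ _) => x; field; rewrite gt_eqF.
  rewrite exprMn [in leRHS]exprMn mulrCA; apply: ler_wpM2l.
    by rewrite exprn_ge0// ltW.
  rewrite -[X in _ <= X]powR_mulrn ?powR_ge0// -powRrM mulVf ?pnatr_eq0//
    powRr1 ?(ltW q0)//.
  by rewrite ler_pdivlMr// mulrC mulrA; exact: hpsi.
have err' : a * (A + a) * enorm e <= (A + a) * (rho * r).
  by rewrite mulrAC mulrC; apply: ler_wpM2l => //; exact: ltW.
have AG : 2 * (a * A * G) <= (A + a) * (eps * a).
  apply: le_trans (_ : a * (eps * a) <= _); first rewrite -mulrA mulrCA.
    by apply: ler_wpM2l; [exact: ltW|rewrite mulrA].
  by apply: ler_wpM2r; [rewrite mulr_ge0// ltW|rewrite lerDr].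
have rB' : (A + a) * ((1 + rho) * r) <= (A + a) * (eps * a / 2).
  by apply: ler_wpM2l => //; exact: ltW.
have : a * ((A + a) * enorm g') <= a * ((A + a) * eps) by lra.
by rewrite ler_pM2l// ler_pM2l.
Qed.

End State.
End Step.

(** * Scalar inequalities behind the rate *)

Section Rate.
Variables (R : realType) (m : nat).
Local Notation e := (2 / (3 * m.+2%:R - 1) : R).
Local Notation kappa := (2 / m.+1%:R : R).
Implicit Types (A a r c mu Y D : R).

Lemma rate_den_gt0 : 0 < 3 * m.+2%:R - 1 :> R.
Proof. by rewrite subr_gt0 -natrM ltr1n mulnS. Qed.

Lemma rate_gt0 : 0 < e.
Proof. by rewrite divr_gt0// rate_den_gt0. Qed.

Lemma rate_le1 : e <= 1.
Proof.
rewrite ler_pdivrMr ?rate_den_gt0// mul1r lerBrDr -natrM -(natrD _ 2 1) ler_nat.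
by rewrite mulnS leq_addr.
Qed.

(** The tangent inequality at [t x], evaluated at [x] and at 0, is averaged with weights [t] and
    [1 - t]. For [u = expR x] it reads [u^t <= 1 - t + t u], the concavity of powers. *)
Lemma expR_concave (x t : R) : 0 <= t <= 1 -> expR (t * x) <= 1 - t + t * expR x.
Proof.
move=> /andP[t0 t1].
have h1 : expR (t * x) * (1 + (1 - t) * x) <= expR x.
  have -> : expR x = expR (t * x) * expR ((1 - t) * x).
    by rewrite -expRD; congr expR; ring.
  by rewrite ler_pM2l ?expR_gt0// expR_ge1Dx.
have h2 : expR (t * x) * (1 - t * x) <= 1.
  rewrite -[leRHS](expRxMexpNx_1 (t * x)) ler_pM2l ?expR_gt0//.
  exact: expR_ge1Dx.
have h3 := ler_wpM2l t0 h1.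
have t1' : 0 <= 1 - t by rewrite subr_ge0.
have h4 := ler_wpM2l t1' h2.
lra.
Qed.

Lemma powR_increment A a (t : R) : 0 < t <= 1 -> 0 <= A -> 0 < a ->
  t * ((A + a) `^ t * (a / (A + a))) <= (A + a) `^ t - A `^ t.
Proof.
move=> /andP[t0 t1] A0 a0; have Aa0 : 0 < A + a by rewrite ltr_wpDl.
have uA : A = (A + a) * (A / (A + a)) by rewrite mulrC divfK// gt_eqF.
have u0 : 0 <= A / (A + a) by rewrite divr_ge0// ltW.
have -> : A `^ t = (A + a) `^ t * (A / (A + a)) `^ t.
  by rewrite {1}uA powRM// ltW.
have -> : a / (A + a) = 1 - A / (A + a) by field; rewrite gt_eqF.
suff : (A / (A + a)) `^ t <= 1 - t + t * (A / (A + a)).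
  have := powR_gt0 t Aa0; set y := _ `^ t; set u := A / _; nra.
have [->|un0] := eqVneq (A / (A + a)) 0.
  by rewrite powR0 ?gt_eqF// mulr0 addr0 subr_ge0.
have up : 0 < A / (A + a) by rewrite lt_def un0.
have t01 : 0 <= t <= 1 by rewrite ltW.
by have := expR_concave (ln (A / (A + a))) t01; rewrite /powR (negbTE un0) lnK.
Qed.

(* Either [A^e] grows by a definite amount, or the movement term does. *)
Lemma step_count A a r (c0 : R) mu Y : 0 <= A -> 0 < a -> 0 <= r -> 0 < c0 -> 0 < mu ->
  c0 <= a * r ^+ m.+1 -> (A + a) `^ e <= Y ->
  1 <= ((A + a) `^ e - A `^ e) / (e * mu) +
       Y * (mu ^+ m.+2 / c0) `^ kappa * ((A + a) * r / a) ^+ 2.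
Proof.
move=> A0 a0 r0 c00 mu0 cr yY; have Aa0 : 0 < A + a by rewrite ltr_wpDl.
have e0 := rate_gt0; have e1 := rate_le1.
have em0 : 0 < e * mu by rewrite mulr_gt0.
have y0 : 0 < (A + a) `^ e := powR_gt0 _ Aa0.
have inc := powR_increment (introT andP (conj e0 e1)) A0 a0.
set y := (A + a) `^ e in yY y0 inc *.
have beta0 : 0 <= Y * (mu ^+ m.+2 / c0) `^ kappa.
  by rewrite mulr_ge0 ?powR_ge0// (le_trans (ltW y0)).
have U0 : 0 < (A + a) / a by rewrite divr_gt0.
have [big|small] := leP mu (y * (a / (A + a))).
  rewrite -[X in X <= _]addr0; apply: lerD.
    2: by apply: mulr_ge0 => //; exact: sqr_ge0.
  rewrite ler_pdivlMr// mul1r; apply: le_trans inc.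
  by rewrite ler_pM2l.
rewrite -[X in X <= _]add0r; apply: lerD.
  apply: divr_ge0; last exact: ltW.
  apply: le_trans inc; rewrite mulr_ge0 ?(ltW e0)// mulr_ge0 ?(ltW y0)//.
  by rewrite divr_ge0 ?ltW.
have yU : y / mu <= (A + a) / a.
  rewrite ler_pdivrMr// mulrC -ler_pdivrMr// invf_div; exact: ltW.
have Ur0 : 0 <= (A + a) * r / a := divr_ge0 (mulr_ge0 (ltW Aa0) r0) (ltW a0).
have ymu0 : 0 <= y / mu := divr_ge0 (ltW y0) (ltW mu0).
(* One factor [(A + a) / a] is borrowed from the power, so that [a r^(p-1)] appears and the line
   search bound applies. *)
pose t := (y / mu) ^+ m.+2 * (c0 / (A + a)).
have t_le : t <= ((A + a) * r / a) ^+ m.+1.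
  have -> : ((A + a) * r / a) ^+ m.+1 =
      ((A + a) / a) ^+ m.+2 * ((a * r ^+ m.+1) / (A + a)).
    rewrite mulrAC exprMn [in RHS]exprS; field.
    by rewrite !gt_eqF.
  apply: ler_pM.
  - exact: exprn_ge0.
  - exact: divr_ge0 (ltW c00) (ltW Aa0).
  - by rewrite lerXn2r// nnegrE ltW.
  - by rewrite ler_wpM2r// invr_ge0 ltW.
have k0 : 0 <= kappa by rewrite divr_ge0.
have t0 : 0 <= t := mulr_ge0 (exprn_ge0 _ ymu0) (divr_ge0 (ltW c00) (ltW Aa0)).
have tk : t `^ kappa <= ((A + a) * r / a) ^+ 2.
  have := ge0_ler_powR k0 t0 (exprn_ge0 m.+1 Ur0) t_le.
  rewrite -[X in _ <= X `^ _ -> _]powR_mulrn// -powRrM.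
  have -> : m.+1%:R * kappa = 2%:R by rewrite mulrC divfK// pnatr_eq0.
  by rewrite powR_mulrn.
have mt : (mu ^+ m.+2 / c0) `^ kappa * t `^ kappa = y^-1.
  rewrite -powRM//; last exact: divr_ge0 (exprn_ge0 _ (ltW mu0)) (ltW c00).
  have -> : mu ^+ m.+2 / c0 * t = y ^+ m.+2 / (A + a).
    rewrite /t expr_div_n; field.
    by rewrite expf_neq0 !gt_eqF.
  have -> : y ^+ m.+2 / (A + a) = (A + a) `^ (e * m.+2%:R - 1).
    rewrite powRD ?(gt_eqF Aa0) ?implybT// powR_inv1 ?(ltW Aa0)// powRrM.
    by rewrite powR_mulrn// ltW.
  (* What remains is [(e p - 1) kappa = - e], the equation that determines [e]. *)
  rewrite -powRrM /y -powRN; congr (_ `^ _).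
  field.
  by rewrite nat1r pnatr_eq0 andbT -(natrD _ 2 m) gt_eqF// rate_den_gt0.
apply: (@le_trans _ _ (Y * (mu ^+ m.+2 / c0) `^ kappa * t `^ kappa)).
  by rewrite -mulrA mt ler_pdivlMr// mul1r.
by apply: ler_wpM2l.
Qed.

(** This [mu] makes the two budgets proportional to the same [Y / mu]; it solves the equation
    because [p kappa + 1 = kappa / e]. *)
Lemma rate_balance D (c0 : R) (mu := (c0 / D ^+ m.+1) `^ e) : 0 < D -> 0 < c0 ->
  (mu ^+ m.+2 / c0) `^ kappa * D ^+ 2 = mu^-1.
Proof.
move=> D0 c00.
have q0 : 0 < c0 / D ^+ m.+1 by rewrite divr_gt0// exprn_gt0.
have [x cE] : exists x, c0 = expR x by exists (ln c0); rewrite lnK.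
have [y DE] : exists y, D = expR y by exists (ln D); rewrite lnK.
have muE : mu = expR ((x - m.+1%:R * y) * e).
  by rewrite /mu cE DE -expRM_natl -expRB expRM mulrC.
rewrite muE -expRM_natl cE DE -expRB -expRM_natl -expRN -expRM -expRD.
congr expR; field.
by rewrite nat1r pnatr_eq0 andbT -(natrD _ 2 m) gt_eqF// rate_den_gt0.
Qed.

End Rate.

(** * Counting the accepted steps *)

Section Complexity.
Variables (R : realType) (d m : nat) (F : 'rV[R]_d -> 'rV[R]_d).
Variables (H : 'rV[R]_d -> set 'rV[R]_d) (L : R) (zs z0 : 'rV[R]_d) (eps : R).
Hypothesis mF : monotone_map F.
Hypothesis Fm : continuously_differentiable m.+1 F.
Hypothesis L_gt0 : 0 < L.
Hypothesis F_lip : forall z z' : 'rV[R]_d,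
  (opnorm (fun h : (m.+1).-tuple 'rV[R]_d => (iterdiff F h z - iterdiff F h z')%R)
     <= (L * enorm (z - z'))%:E)%E.
Hypothesis mH : maximal_monotone H.
Hypothesis star : exists2 v, H zs v & 0 = F zs + v.
Hypothesis eps_gt0 : 0 < eps.

Local Notation p := m.+2.
Local Notation D := (enorm (z0 - zs)).
Local Notation e := (2 / (3 * p%:R - 1) : R).
Local Notation c0 := (p`!%:R / (2 * aep_M p L)).
Local Notation Y := ((2 * D / eps) `^ e).

Let H0 : exists u, op_dom H u.
Proof. by have [v Hv _] := star; exists zs, v. Qed.

(** Replacing [z0] by [zs] in the linear term costs at most [A |g| D]; the rest is nonnegative since
    [F + H] is monotone and contains 0 at [zs]. *)
Lemma potential_ge st : H (aep_z st) (aep_v st) -> 0 <= aep_A st ->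
  (aep_A st * enorm (F (aep_z st) + aep_v st)) ^+ 2 / 2 -
  (aep_A st * enorm (F (aep_z st) + aep_v st)) * D <= potential F z0 st.
Proof.
move=> Hv A0; have [w Hw Fw] := star.
have mono : 0 <= dot (F (aep_z st) + aep_v st) (aep_z st - zs).
  have -> : F (aep_z st) + aep_v st = (F (aep_z st) - F zs) + (aep_v st - w).
    by rewrite addrACA -opprD -Fw subr0.
  by rewrite dotDl; apply: addr_ge0; [exact: mF|exact: (mH.1 _ _ _ _ Hv Hw)].
rewrite /potential; move: (F _ + _) mono => g mono.
have -> : aep_z st - z0 = (aep_z st - zs) - (z0 - zs).
  by rewrite opprB addrA subrK.
rewrite [dot g (_ - _)]dotDr dotNr -enorm_sqr.
have := ler_wpM2l A0 (cauchy_schwarz g (z0 - zs)).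
have := mulr_ge0 A0 mono.
move: (dot g _) (dot g _) => x y; lra.
Qed.

Lemma potential_bounded_below st : H (aep_z st) (aep_v st) -> 0 <= aep_A st ->
  - (D ^+ 2 / 2) <= potential F z0 st.
Proof.
move=> Hv A0; apply: le_trans (potential_ge Hv A0).
set x := _ * enorm (F _ + _); have := sqr_ge0 (x - D); lra.
Qed.

Lemma residual_bound st : H (aep_z st) (aep_v st) -> 0 <= aep_A st ->
  potential F z0 st <= 0 ->
  aep_A st * enorm (F (aep_z st) + aep_v st) <= 2 * D.
Proof.
move=> Hv A0 V0; have := le_trans (potential_ge Hv A0) V0.
set x := _ * enorm (F _ + _); have D0 := enorm_ge0 (z0 - zs).
have [x0|x0] := leP x 0; first by move=> _; lra.
move=> h; have : x * x <= x * (2 * D) by lra.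
by rewrite ler_pM2l.
Qed.

Lemma res_tan_le z v : H z v -> enorm (F z + v) <= eps ->
  (res_tan F H z <= eps%:E)%E.
Proof.
move=> Hv le_eps; apply: (@le_trans _ _ (enorm (F z + v))%:E).
  by apply: ereal_inf_lbound; exists v.
by rewrite lee_fin.
Qed.

Lemma c0_gt0 : 0 < c0.
Proof. by rewrite divr_gt0 ?fact_gt0R// mulr_gt0 ?aep_M_gt0. Qed.

(** The lower threshold is [p! / 2], and division by [M] gives [c0]. *)
Lemma accepted_step st a : p`!%:R * aep_rho R / Num.sqrt 2 <= aep_psi p F H L z0 st a ->
  c0 <= a * enorm (aep_next p F H L z0 st a - aep_half F z0 st a) ^+ m.+1.
Proof.
have M0 : 0 < aep_M p L by apply: aep_M_gt0.
have -> : p`!%:R * aep_rho R / Num.sqrt 2 = p`!%:R / 2.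
  by rewrite -mulrA /aep_rho -invfM -expr2 sqr_sqrtr.
rewrite /aep_psi ler_pdivrMr// => h; rewrite ler_pdivrMr ?mulr_gt0//.
by apply: le_trans h _; rewrite le_eqVlt; apply/orP; left; apply/eqP; ring.
Qed.

Section Budget.
Variable mu : R.
Hypothesis mu_gt0 : 0 < mu.
Let beta := Y * (mu ^+ m.+2 / c0) `^ (2 / m.+1%:R).
(** The first term pays for the growth of [A^e]. The potential falls by at most [D^2 / 2], and the
    factor 4 that undoes the quarter in its decrease yields the second term. *)
Let K := Y / (e * mu) + 2 * beta * D ^+ 2.

Let beta_ge0 : 0 <= beta.
Proof. by rewrite mulr_ge0 ?powR_ge0. Qed.

Let emu_gt0 : 0 < e * mu.
Proof. by rewrite mulr_gt0 ?rate_gt0. Qed.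

Lemma weight_rate st : H (aep_z st) (aep_v st) -> 0 <= aep_A st ->
  potential F z0 st <= 0 -> eps < enorm (F (aep_z st) + aep_v st) ->
  aep_A st `^ e <= Y.
Proof.
move=> Hv A0 V0 big; apply: ge0_ler_powR.
- exact: ltW (rate_gt0 _ _).
- by [].
- by rewrite nnegrE divr_ge0 ?mulr_ge0 ?enorm_ge0// ltW.
rewrite ler_pdivlMr//; apply: le_trans (residual_bound Hv A0 V0).
by apply: ler_wpM2l => //; exact: ltW.
Qed.

Lemma budget_bound st (x : R) : H (aep_z st) (aep_v st) -> 0 <= aep_A st ->
  potential F z0 st <= 0 -> eps < enorm (F (aep_z st) + aep_v st) ->
  x <= aep_A st `^ e / (e * mu) - 4 * beta * potential F z0 st -> x <= K.
Proof.
move=> Hv A0 V0 big /le_trans; apply.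
have h1 := ler_wpM2l beta_ge0 (potential_bounded_below Hv A0).
have i0 : 0 <= (e * mu)^-1 by rewrite invr_ge0 ltW.
have h2 := ler_wpM2r i0 (weight_rate Hv A0 V0 big).
rewrite /K; move: h1 h2; set y1 := _ / (e * mu); set y2 := _ / (e * mu); lra.
Qed.

(** [k] counts the steps already made. The sharp count is carried only while the residual exceeds
    [eps], where [weight_rate] applies; it then forces [k <= K], so one more step stays within
    [K + 1] and the fuel cannot run out. *)
Lemma aep_run_exists fuel k st :
  H (aep_z st) (aep_v st) -> 0 <= aep_A st -> potential F z0 st <= 0 ->
  k%:R <= K + 1 ->
  (eps < enorm (F (aep_z st) + aep_v st) ->
     k%:R <= aep_A st `^ e / (e * mu) - 4 * beta * potential F z0 st) ->
  K < (k + fuel)%:R ->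
  exists n zhat, [/\ aep_run p F H L z0 eps st n zhat,
    (res_tan F H zhat <= eps%:E)%E & (k + n)%:R <= K + 1].
Proof.
elim: fuel k st => [|fuel IH] k st Hv A0 V0 kK count Kk;
  have [small|big] := leP (enorm (F (aep_z st) + aep_v st)) eps.
- exists 0%N, (aep_z st); rewrite addn0; split=> //; first exact: Run_stop.
  exact: res_tan_le Hv small.
- have := budget_bound Hv A0 V0 big (count big).
  by rewrite leNgt -[k]addn0 Kk.
- exists 0%N, (aep_z st); rewrite addn0; split=> //; first exact: Run_stop.
  exact: res_tan_le Hv small.
have abar0 : 0 < aep_abar p F L eps st by apply: aep_abar_gt0.
have [le_psi|gt_psi] := leP (aep_psi p F H L z0 st (aep_abar p F L eps st))
                            (p`!%:R * aep_rho R).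
  exists 0%N, (aep_next p F H L z0 st (aep_abar p F L eps st)).
  rewrite addn0; split=> //; first exact: Run_upper.
  have [Hn _] := aep_next_spec z0 mF Fm L_gt0 F_lip mH H0 st abar0.
  apply: res_tan_le Hn _; exact: aep_upper_residual.
have [a bis] := aep_bisect_terminates mF Fm L_gt0 F_lip mH H0 Hv A0 abar0 gt_psi.
have [a0 psi1 psi2] := aep_bisectP bis (lexx 0) abar0.
have [Hn _] := aep_next_spec z0 mF Fm L_gt0 F_lip mH H0 st a0.
set st' := aep_update p F H L z0 st a.
have Hn' : H (aep_z st') (aep_v st') := Hn.
have dec : potential F z0 st' <= _ :=
  potential_decrease mF Fm L_gt0 F_lip mH H0 Hv A0 a0 psi2.
have A0' : 0 <= aep_A st' by rewrite addr_ge0// ltW.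
have V0' : potential F z0 st' <= 0.
  by apply: le_trans dec _; rewrite subr_le0 (le_trans V0)// divr_ge0// sqr_ge0.
have kS : k.+1%:R <= K + 1.
  by rewrite -natr1 lerD2r; exact: budget_bound (count big).
have [||n [zhat [run res nK]]] := IH k.+1 st' Hn' A0' V0' kS _ _.
- move=> big'; have yY := weight_rate Hn' A0' V0' big'.
  have := step_count A0 a0 (enorm_ge0 _) c0_gt0 mu_gt0 (accepted_step psi1) yY.
  have := ler_wpM2l beta_ge0 dec; have := count big.
  rewrite -natr1 -/beta [aep_A st']/=.
  set X := (_ * _ / a) ^+ 2; rewrite mulrBl.
  set y1 := _ / (e * mu); set y2 := _ / (e * mu); lra.
- by rewrite addSnnS.
exists n.+1, zhat; rewrite -addSnnS; split=> //.
exact: Run_accept big gt_psi bis run.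
Qed.

End Budget.

Lemma aep_complexity v0 : H z0 v0 ->
  exists n zhat, [/\ aep_tensor_returns p F H L z0 eps v0 n zhat,
    (res_tan F H zhat <= eps%:E)%E &
    n%:R <= (e^-1 + 2) * (4 * p.+1%:R / p`!%:R) `^ e *
            (L * D ^+ p / eps) `^ e + 1].
Proof.
move=> Hv0.
have e_gt0 : 0 < e := rate_gt0 _ _.
(* For [D = 0] both [Y] and [K] vanish, whatever positive [mu] is taken. *)
pose mu := if D == 0 then 1 else (c0 / D ^+ m.+1) `^ e.
have D_ge0 := enorm_ge0 (z0 - zs).
have mu0 : 0 < mu.
  rewrite /mu; case: eqVneq => // Dn0; apply: powR_gt0.
  by rewrite divr_gt0 ?c0_gt0// exprn_gt0// lt_def Dn0.
pose K := Y / (e * mu) + 2 * (Y * (mu ^+ m.+2 / c0) `^ (2 / m.+1%:R)) * D ^+ 2.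
have KE : K = (e^-1 + 2) * (4 * p.+1%:R / p`!%:R) `^ e * (L * D ^+ p / eps) `^ e.
  have [D0|Dn0] := eqVneq D 0.
    rewrite /K D0 mulr0 mul0r !expr0n /= !mulr0 mul0r powR0 ?gt_eqF//.
    by rewrite mulr0 !mul0r addr0.
  have Dp : 0 < D by rewrite lt_def Dn0.
  have muE : mu = (c0 / D ^+ m.+1) `^ e by rewrite /mu (negbTE Dn0).
  have bal := rate_balance m Dp c0_gt0; rewrite -muE in bal.
  have -> : K = (e^-1 + 2) * (Y * mu^-1).
    rewrite /K; move: (e) (Y) => t y.
    by rewrite -[2 * (y * _) * _]mulrA -[y * _ * _]mulrA bal invfM; ring.
  have q0 : 0 <= c0 / D ^+ m.+1 by rewrite divr_ge0 ?exprn_ge0// ltW ?c0_gt0.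
  have pf : 0 < p`!%:R :> R := fact_gt0R _ _.
  have r1 : 0 <= 4 * p.+1%:R / p`!%:R :> R by rewrite divr_ge0.
  have r2 : 0 <= L * D ^+ p / eps.
    by rewrite divr_ge0 ?(ltW eps_gt0)// mulr_ge0 ?exprn_ge0// ltW.
  (* [Y / mu] is the power [e] of [(2 D / eps) D^(p-1) / c0]; inserting [M = (p + 1) L] into [c0]
     produces the constant. *)
  have YE : Y = (4 * p.+1%:R / p`!%:R) `^ e * (L * D ^+ p / eps) `^ e * mu.
    rewrite muE -(powRM _ r1 r2) -(powRM _ (mulr_ge0 r1 r2) q0).
    congr (_ `^ _).
    rewrite /aep_M /aep_lambda (exprS _ m.+1); field.
    have M0 : L + (2 + m%:R) * L != 0.
      by rewrite -(natrD _ 2 m) gt_eqF// (aep_M_gt0 m L_gt0).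
    by rewrite M0 (gt_eqF eps_gt0) (gt_eqF pf) expf_neq0.
  by rewrite YE mulfK ?gt_eqF// mulrA.
have KE_ge0 : 0 <= K by rewrite KE !mulr_ge0 ?powR_ge0// addr_ge0// invr_ge0 ltW.
have hfuel := archi_boundP KE_ge0.
have V00 : potential F z0 (AepState z0 v0 0) = 0.
  by rewrite /potential /= expr0n /= !mul0r addr0.
have [|||n [zhat [run res nK]]] := @aep_run_exists mu mu0 _ 0 (AepState z0 v0 0)
    Hv0 (lexx 0) _ _ _ hfuel.
- by rewrite V00.
- by rewrite addr_ge0.
- by move=> _; rewrite V00 /= mulr0 subr0 powR0 ?mul0r// gt_eqF.
by exists n, zhat; split=> //; rewrite -KE.
Qed.

End Complexity.

Theorem theorem5p2 (R : realType) (p : nat) (hp : (2 <= p)%N) :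
  exists C : R, 0 < C /\
  forall (d : nat) (F : 'rV[R]_d -> 'rV[R]_d)
         (H : 'rV[R]_d -> set 'rV[R]_d) (Lp : R) (zstar z0 : 'rV[R]_d) (eps : R),
    monotone_map F ->
    continuously_differentiable p.-1 F ->
    0 < Lp ->
    (forall z z' : 'rV[R]_d,
       (opnorm (fun h : (p.-1).-tuple 'rV[R]_d =>
                  (iterdiff F h z - iterdiff F h z')%R)
        <= (Lp * enorm (z - z'))%:E)%E) ->
    maximal_monotone H ->
    (exists2 v, H zstar v & 0 = F zstar + v) ->
    op_dom H z0 ->
    0 < eps ->
    forall v0 : 'rV[R]_d, H z0 v0 ->
    exists (n : nat) (zhat : 'rV[R]_d),
      [/\ aep_tensor_returns p F H Lp z0 eps v0 n zhat,
          (res_tan F H zhat <= eps%:E)%E &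
          n%:R <= C * (1 + (Lp * enorm (z0 - zstar) ^+ p / eps)
                             `^ (2 / (3 * p%:R - 1)))].
Proof.
case: p hp => [|[|m]]// _.
set c : R := ((2 / (3 * m.+2%:R - 1))^-1 + 2) *
  (4 * m.+3%:R / m.+2`!%:R) `^ (2 / (3 * m.+2%:R - 1)).
have c_ge0 : 0 <= c.
  by rewrite mulr_ge0 ?powR_ge0// addr_ge0// invr_ge0 ltW// rate_gt0.
(* With [x] the rate term, [c x + 1 <= (c + 1) (1 + x)]. *)
exists (c + 1); split; first by rewrite ltr_wpDl.
move=> d F H L zs z0 eps mF Fm L0 F_lip mH star _ eps0 v0 Hv0.
have [n [zhat [run res nK]]] := aep_complexity mF Fm L0 F_lip mH star eps0 Hv0.
exists n, zhat; split=> //; apply: le_trans nK _; rewrite -/c.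
by have := powR_ge0 (L * enorm (z0 - zs) ^+ m.+2 / eps) (2 / (3 * m.+2%:R - 1)); nra.
Qed.
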